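(* There exists a constant $d$ such that for every $N$ and all binary strings $a,b,c$ of length at most $N$ satisfying $$\mathrm{KS}(a\mid c)\ge \mathrm{KS}(b\mid c)+\mathrm{KS}(b\mid a)+d\log N$$ there exists a binary string $f$ of length at most $\mathrm{KS}(b\mid a)+d\log N$ such that $\mathrm{KS}(b\mid a,f)\le d\log N$ and $\mathrm{KS}(b\mid c,f)\ge \mathrm{KS}(b\mid c)-d\log N$.
   Context: $\mathrm{KS}(u\mid v)$ denotes conditional Kolmogorov complexity of binary strings with respect to a fixed optimal programming language; conditioning on two strings means conditioning on an encoding of the pair.
   Formalization: The formal theorem takes N ≥ 2 instead of every N (log N is the floor of the base-2 logarithm): log 0 is undefined, and for N = 1 the slack d log N is 0 and the claim fails for some optimal languages. *)

(* Defs.v *)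
From Stdlib Require Import Arith List ClassicalEpsilon.
Import ListNotations.

Inductive PR : Type :=
| PZero : PR
| PSucc : PR
| PProj : nat -> PR
| PComp : PR -> list PR -> PR
| PRec  : PR -> PR -> PR
| PMu   : PR -> PR.

Fixpoint eval (fuel : nat) (e : PR) (args : list nat) {struct fuel} : option nat :=
  match fuel with
  | 0 => None
  | S k =>
    match e with
    | PZero => Some 0
    | PSucc => Some (S (hd 0 args))
    | PProj i => Some (nth i args 0)
    | PComp f gs =>
        let fix evals (gs : list PR) : option (list nat) :=
          match gs with
          | [] => Some []
          | g :: gs' =>
              match eval k g args, evals gs' with
              | Some v, Some vs => Some (v :: vs)
              | _, _ => None
              end
          end in
        match evals gs with
        | Some vs => eval k f vs
        | None => None
        end
    | PRec f g =>
        let n := hd 0 args in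
        let rest := tl args in
        let fix go (m : nat) : option nat :=
          match m with
          | 0 => eval k f rest
          | S m' => match go m' with
                    | Some r => eval k g (m' :: r :: rest)
                    | None => None
                    end
          end in
        go n
    | PMu f =>
        let fix srch (cnt y : nat) : option nat :=
          match cnt with
          | 0 => None
          | S c => match eval k f (y :: args) with
                   | Some 0 => Some y
                   | Some _ => srch c (S y)
                   | None => None
                   end
          end in
        srch k 0
    end
  end.

Definition bstring := list bool.

(* bijective base-2 numbering of binary strings *)
Fixpoint enc (s : bstring) : nat :=
  match s with
  | [] => 0
  | b :: s' => 2 * enc s' + (if b then 2 else 1)
  end.

Definition pair_str (x y : bstring) : bstring :=
  flat_map (fun b => [b; b]) x ++ [false; true] ++ y.

(* D p y x : on program p with condition y, D outputs x *)
Definition decompressor := bstring -> bstring -> bstring -> Prop.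

Definition computable_dec (D : decompressor) : Prop :=
  exists e : PR, forall p y x,
    D p y x <-> exists fuel, eval fuel e [enc p; enc y] = Some (enc x).

Definition optimal (U : decompressor) : Prop :=
  computable_dec U /\
  forall D, computable_dec D ->
    exists c, forall p y x, D p y x ->
      exists q, length q <= length p + c /\ U q y x.

Definition KS_is (U : decompressor) (x y : bstring) (k : nat) : Prop :=
  (exists p, length p = k /\ U p y x) /\ (forall p, U p y x -> k <= length p).

Definition KS (U : decompressor) (x y : bstring) : nat :=
  epsilon (inhabits 0) (fun k => KS_is U x y k).

Definition lg (N : nat) : nat := Nat.log2 N.

(* Main.v *)
Require Import Defs.
From Stdlib Require Import Arith List ClassicalEpsilon.
From Stdlib Require Import Bool Lia PArith.
Import ListNotations.

(* Let k = KS(b|a), m = KS(b|c).  The string f is a hash of the pair (a,b) with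
   about k bits, f = E(a,s) + E(b,t) modulo a power of 2, where E is a bipartite
   graph of degree D = O(N) such that, for every set B of at most 2^j right
   vertices (j = k - O(log N)), at most 2^j left vertices have half of their
   neighbours in B.  Such E exist by a potential argument, hence one can be found
   by exhaustive search.
   Given a, at most 2^j hash values are shared by more than poly(N) strings b' with
   KS(b'|a) <= k.  If for some s half of the t led to such a value, then b would be
   one of at most D 2^j enumerable strings, and KS(b|a) < k.
   Given c and b, let B be the set of values f with KS(b|c,f) < r = m - O(log N).
   If B has more than 2^j elements then b is one of at most 2^(r+3) enumerable
   strings, and KS(b|c) < m.  Otherwise, if for some t half of the s led into B,
   then a would be one of D 2^j strings enumerable from c and b, contradicting the
   lower bound on KS(a|c).  So fewer than half of all pairs (s,t) are bad for either
   reason, and some pair is good for both. *)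

(** The obstacle: [f] must help whoever knows [a] without helping whoever knows [c], and a hash of
    [b] alone would in general serve both. Mixing in [a] acts like a one-time pad. Describing [b]
    from [c] takes m bits and locating [a] in a set of [D * 2 ^ j] strings takes about j bits, less
    than [KS(a|c)] by hypothesis, so [a] stays unpredictable even to someone who holds both [c] and
    [b].

    Addition is used because, with one string and its edge fixed, the hash is a translate of a
    neighbour of the other string; one property of [E] thus serves both sides.

    The exceptional sets are only enumerable. Each is a union of decidable stages (evaluation with
    fuel [w]), is bounded stage by stage, and the bound is carried over to the union. The proviso
    that B has at most [2 ^ j] elements must itself be tested at a stage and may fail later; this is
    the one place where the stages do not simply grow.

    The table [E] costs no bits: it is the first one found by a search that reads only the numerical
    parameters, and these have [O(log N)] bits. *)

(** * Computable functions *)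

(** This and the next two are the anonymous local fixpoints of [eval], abstracted so that the
    unfolding equations hold by conversion. *)
Definition opt_list (F : PR -> option nat) : list PR -> option (list nat) :=
  fix evals gs := match gs with
  | [] => Some []
  | g :: gs' => match F g, evals gs' with Some v, Some vs => Some (v :: vs) | _, _ => None end
  end.

Definition opt_rec (base : option nat) (step : nat -> nat -> option nat) : nat -> option nat :=
  fix go m := match m with
  | 0 => base
  | S m' => match go m' with Some r => step m' r | None => None end
  end.

Definition opt_search (F : nat -> option nat) : nat -> nat -> option nat :=
  fix srch cnt y := match cnt with
  | 0 => None
  | S c => match F y with Some 0 => Some y | Some _ => srch c (S y) | None => None end
  end.

Lemma eval_comp k f gs v : eval (S k) (PComp f gs) v =
  match opt_list (fun g => eval k g v) gs with Some vs => eval k f vs | None => None end.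
Proof. reflexivity. Qed.

Lemma eval_rec k f g v : eval (S k) (PRec f g) v =
  opt_rec (eval k f (tl v)) (fun m r => eval k g (m :: r :: tl v)) (hd 0 v).
Proof. reflexivity. Qed.

Lemma eval_mu k f v : eval (S k) (PMu f) v = opt_search (fun y => eval k f (y :: v)) k 0.
Proof. reflexivity. Qed.

Lemma opt_list_mono F F' gs vs :
  (forall g x, F g = Some x -> F' g = Some x) ->
  opt_list F gs = Some vs -> opt_list F' gs = Some vs.
Proof.
  intros H; revert vs; induction gs as [|g gs IH]; intros vs; simpl; auto.
  destruct (F g) as [x|] eqn:E; try discriminate.
  destruct (opt_list F gs) as [xs|] eqn:E'; try discriminate.
  rewrite (H _ _ E), (IH _ eq_refl); auto.
Qed.

Lemma opt_rec_mono b b' s s' m x :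
  (forall x, b = Some x -> b' = Some x) ->
  (forall i r x, s i r = Some x -> s' i r = Some x) ->
  opt_rec b s m = Some x -> opt_rec b' s' m = Some x.
Proof.
  intros H H'; revert x; induction m as [|m IH]; intros x; simpl; auto.
  destruct (opt_rec b s m) as [r|] eqn:E; try discriminate.
  rewrite (IH _ eq_refl); auto.
Qed.

Lemma opt_search_mono F F' c c' y x :
  (forall i x, F i = Some x -> F' i = Some x) -> c <= c' ->
  opt_search F c y = Some x -> opt_search F' c' y = Some x.
Proof.
  intros H; revert c' y; induction c as [|c IH]; intros c' y Hc; simpl; try discriminate.
  destruct c' as [|c']; [lia|]; simpl.
  destruct (F y) as [r|] eqn:E; try discriminate; rewrite (H _ _ E).
  destruct r; auto; apply IH; lia.
Qed.

Lemma eval_mono k k' e v x : k <= k' -> eval k e v = Some x -> eval k' e v = Some x.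
Proof.
  revert k' e v x; induction k as [|k IH]; intros k' e v x Hk; [discriminate|].
  destruct k' as [|k']; [lia|]; assert (Hk' : k <= k') by lia.
  destruct e as [| |i|f gs|f g|f]; auto.
  - rewrite !eval_comp.
    destruct (opt_list _ gs) as [vs|] eqn:E; try discriminate.
    rewrite (opt_list_mono _ (fun g => eval k' g v) _ _ (fun g x => IH k' g v x Hk') E); auto.
  - rewrite !eval_rec; apply opt_rec_mono; auto.
  - rewrite !eval_mu; apply opt_search_mono; auto.
Qed.

Definition Ev (e : PR) (v : list nat) (x : nat) : Prop := exists k, eval k e v = Some x.

Lemma Ev_comp f gs v ws x :
  Forall2 (fun g w => Ev g v w) gs ws -> Ev f ws x -> Ev (PComp f gs) v x.
Proof.
  intros H [k Hk].
  assert (exists k, opt_list (fun g => eval k g v) gs = Some ws) as [k' Hk'].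
  { clear Hk; induction H as [|g w gs ws [i Hi] _ [i' Hi']]; [exists 0; auto|].
    exists (i + i'); simpl.
    rewrite (eval_mono _ (i + i') _ _ _ (Nat.le_add_r _ _) Hi).
    erewrite opt_list_mono; [reflexivity| |exact Hi'].
    cbv beta; intros; eapply eval_mono; [|eassumption]; lia. }
  exists (S (k + k')); rewrite eval_comp.
  erewrite opt_list_mono; [| |exact Hk'].
  - eapply eval_mono; [|exact Hk]; lia.
  - simpl; intros; eapply eval_mono; [|eassumption]; lia.
Qed.

Lemma Ev_rec f g v (F : nat -> nat) :
  Ev f (tl v) (F 0) -> (forall i, Ev g (i :: F i :: tl v) (F (S i))) ->
  Ev (PRec f g) v (F (hd 0 v)).
Proof.
  intros [k0 H0] H.
  assert (forall m, exists k, opt_rec (eval k f (tl v))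
    (fun m r => eval k g (m :: r :: tl v)) m = Some (F m)) as H'.
  { induction m as [|m [k1 IH]]; [exists k0; auto|].
    destruct (H m) as [k2 Hm]; exists (k1 + k2); simpl.
    erewrite opt_rec_mono; [| | |exact IH]; simpl.
    - eapply eval_mono; [|eassumption]; lia.
    - intros; eapply eval_mono; [|eassumption]; lia.
    - intros; eapply eval_mono; [|eassumption]; lia. }
  destruct (H' (hd 0 v)) as [k Hk]; exists (S k); rewrite eval_rec; auto.
Qed.

Lemma Ev_mu f v (F : nat -> nat) z :
  (forall y, Ev f (y :: v) (F y)) -> F z = 0 -> (forall y, y < z -> F y <> 0) ->
  Ev (PMu f) v z.
Proof.
  intros H Hz Hlt.
  assert (exists k, forall y, y <= z -> eval k f (y :: v) = Some (F y)) as [k Hk].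
  { clear Hz Hlt; induction z as [|z [k IH]].
    - destruct (H 0) as [k Hk]; exists k; intros y Hy; replace y with 0 by lia; auto.
    - destruct (H (S z)) as [k' Hk']; exists (k + k'); intros y Hy.
      destruct (Nat.eq_dec y (S z)) as [->|].
      + eapply eval_mono; [|eassumption]; lia.
      + eapply eval_mono; [|apply IH]; lia. }
  (* The fuel must suffice for every single evaluation and also for the [S z] trials, since [eval]
     uses it as the trial counter too. *)
  set (K := k + S z).
  exists (S K); rewrite eval_mu.
  assert (forall y, y <= z -> eval K f (y :: v) = Some (F y)) as HK.
  { intros; eapply eval_mono; [|apply Hk; auto]; unfold K; lia. }
  assert (forall d c y, y + d = z -> d < c ->
    opt_search (fun y => eval K f (y :: v)) c y = Some z) as Hs.
  { induction d as [|d IH]; intros [|c] y Hy Hc; try lia; simpl; rewrite HK by lia.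
    - replace y with z by lia; rewrite Hz; auto.
    - pose proof (Hlt y); destruct (F y); [lia|]; apply IH; lia. }
  apply (Hs z); unfold K; lia.
Qed.

(* [f] is computable on the argument lists of length [n]; its values on other lists are irrelevant. *)
Definition Comp (n : nat) (f : list nat -> nat) : Prop :=
  exists e, forall v, length v = n -> Ev e v (f v).

Definition CompB (n : nat) (f : list nat -> bool) : Prop := Comp n (fun v => Nat.b2n (f v)).

Lemma Comp_b2n n f : CompB n f -> Comp n (fun v => Nat.b2n (f v)).
Proof. auto. Qed.

Lemma Comp_ext n f g : Comp n f -> (forall v, length v = n -> f v = g v) -> Comp n g.
Proof. intros [e H] E; exists e; intros v Hv; rewrite <- E; auto. Qed.

Lemma Comp_compose n m f gs :
  Comp m f -> Forall (Comp n) gs -> length gs = m ->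
  Comp n (fun v => f (map (fun g => g v) gs)).
Proof.
  intros [ef Hf] Hgs Hl.
  assert (exists es, forall v, length v = n ->
    Forall2 (fun e w => Ev e v w) es (map (fun g => g v) gs)) as [es Hes].
  { clear Hl; induction Hgs as [|g gs [e He] _ [es Hes]].
    - exists []; constructor.
    - exists (e :: es); intros v Hv; simpl; constructor; auto. }
  exists (PComp ef es); intros v Hv; eapply Ev_comp; [apply Hes; auto|].
  apply Hf; rewrite length_map; auto.
Qed.

Lemma Comp_nth n j : Comp n (fun v => nth j v 0).
Proof. exists (PProj j); intros v _; exists 1; reflexivity. Qed.

Lemma nth_tl j (v : list nat) : nth j (tl v) 0 = nth (S j) v 0.
Proof. destruct v; auto; destruct j; auto. Qed.

(** Under binders the outer variables are reached through iterated tails; a tail only shifts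
    indices, so they remain projections. *)
Definition Shift (P : list nat -> list nat) : Prop :=
  exists m, forall v j, nth j (P v) 0 = nth (m + j) v 0.

Lemma Shift_id : Shift (fun v => v).
Proof. exists 0; auto. Qed.

Lemma Shift_tl P : Shift P -> Shift (fun v => tl (P v)).
Proof. intros [m H]; exists (S m); intros; rewrite nth_tl, H; f_equal; lia. Qed.

Lemma Comp_proj n P j : Shift P -> Comp n (fun v => nth j (P v) 0).
Proof. intros [m H]; apply Comp_ext with (1 := Comp_nth n (m + j)); auto. Qed.

Lemma map_nth_seq m (v : list nat) n : length v = m + n ->
  map (fun g => g v) (map (fun j v => nth j v 0) (seq m n)) = skipn m v.
Proof.
  intros Hl; rewrite map_map.
  apply nth_ext with (d := 0) (d' := 0); rewrite length_map, length_seq.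
  - rewrite length_skipn; lia.
  - intros i Hi; rewrite nth_skipn.
    rewrite nth_indep with (d' := nth 0 v 0) by (rewrite length_map, length_seq; auto).
    rewrite (map_nth (fun x => nth x v 0) (seq m n) 0 i), seq_nth; auto.
Qed.

Lemma Forall_proj n l : Forall (Comp n) (map (fun j v => nth j v 0) l).
Proof. apply Forall_map, Forall_forall; intros; apply Comp_nth. Qed.

(** Explicit substitution for argument lists: one rule that inserts, drops or permutes leading
    variables and leaves the [n] trailing ones alone. *)
Lemma Comp_subst n m gs f :
  Comp (length gs + n) f -> Forall (Comp (m + n)) gs ->
  Comp (m + n) (fun v => f (map (fun g => g v) gs ++ skipn m v)).
Proof.
  intros Hf Hg.
  apply Comp_ext with (f := fun v => f (map (fun g => g v)
    (gs ++ map (fun j v => nth j v 0) (seq m n)))).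
  - eapply Comp_compose; [exact Hf| |].
    + apply Forall_app; split; auto; apply Forall_proj.
    + rewrite length_app, length_map, length_seq; auto.
  - intros v Hv; rewrite map_app, map_nth_seq; auto.
Qed.

(** * Closure under arithmetic, bounded sums and bounded quantifiers *)

Lemma Comp_const n c : Comp n (fun _ => c).
Proof.
  induction c as [|c [e He]].
  - exists PZero; intros; exists 1; reflexivity.
  - exists (PComp PSucc [e]); intros v Hv; eapply Ev_comp.
    + constructor; [apply He; auto|constructor].
    + exists 1; reflexivity.
Qed.

Lemma Comp_S n f : Comp n f -> Comp n (fun v => S (f v)).
Proof.
  intros [e He]; exists (PComp PSucc [e]); intros v Hv; eapply Ev_comp.
  - constructor; [apply He; auto|constructor].
  - exists 1; reflexivity.
Qed.

Lemma Comp_nat_rect n b f G :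
  Comp n b -> Comp n f -> Comp (S (S n)) (fun v => G (nth 0 v 0) (nth 1 v 0) (tl (tl v))) ->
  Comp n (fun v => nat_rect (fun _ => nat) (f v) (fun i r => G i r v) (b v)).
Proof.
  intros Hb [ef Hf] [eg Hg].
  assert (Comp (S n) (fun v => nat_rect (fun _ => nat) (f (tl v)) (fun i r => G i r (tl v)) (hd 0 v)))
    as H.
  { exists (PRec ef eg); intros v Hv.
    assert (length (tl v) = n) by (destruct v; simpl in *; lia).
    apply Ev_rec with (F := nat_rect (fun _ => nat) (f (tl v)) (fun i r => G i r (tl v))).
    - apply Hf; auto.
    - intros i; specialize (Hg (i :: nat_rect (fun _ => nat) (f (tl v))
        (fun i r => G i r (tl v)) i :: tl v)); simpl in Hg; simpl; apply Hg; lia. }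
  eapply Comp_ext; [apply (Comp_subst n 0 [b]); [exact H|repeat constructor; auto]|].
  intros v Hv; reflexivity.
Qed.

Lemma Comp_weaken2 n H : Comp (S n) H -> Comp (S (S n)) (fun v => H (nth 0 v 0 :: tl (tl v))).
Proof.
  intros HH; eapply Comp_ext; [apply (Comp_subst n 2 [fun v => nth 0 v 0]); simpl; eauto|].
  - repeat constructor; apply Comp_nth.
  - intros [|x [|y v]] Hv; reflexivity.
Qed.

Lemma Comp_match n b f G :
  Comp n b -> Comp n f -> Comp (S n) (fun v => G (nth 0 v 0) (tl v)) ->
  Comp n (fun v => match b v with 0 => f v | S i => G i v end).
Proof.
  intros Hb Hf HG; eapply Comp_ext; [apply (Comp_nat_rect n b f (fun i _ v => G i v)); auto|].
  - apply Comp_weaken2 in HG; exact HG.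
  - intros v _; simpl; destruct (b v); reflexivity.
Qed.

Fixpoint sum (n : nat) (f : nat -> nat) : nat :=
  match n with 0 => 0 | S m => sum m f + f m end.

Definition cnt (n : nat) (P : nat -> bool) : nat := sum n (fun i => Nat.b2n (P i)).

Definition bex (n : nat) (P : nat -> bool) : bool := 0 <? cnt n P.

Lemma Comp_add n f g : Comp n f -> Comp n g -> Comp n (fun v => f v + g v).
Proof.
  intros Hf Hg; eapply Comp_ext; [apply (Comp_nat_rect n g f (fun _ r _ => S r)); auto|].
  - apply Comp_S, Comp_nth.
  - intros v _; simpl; induction (g v); simpl; lia.
Qed.

Lemma Comp_pred n f : Comp n f -> Comp n (fun v => pred (f v)).
Proof. intros Hf; apply (Comp_match n f _ (fun i _ => i)); auto using Comp_nth, Comp_const. Qed.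

Lemma Comp_sub n f g : Comp n f -> Comp n g -> Comp n (fun v => f v - g v).
Proof.
  intros Hf Hg; eapply Comp_ext; [apply (Comp_nat_rect n g f (fun _ r _ => pred r)); auto|].
  - apply Comp_pred, Comp_nth.
  - intros v _; simpl; induction (g v); simpl; lia.
Qed.

Lemma Comp_tl2 n f : Comp n f -> Comp (S (S n)) (fun v => f (tl (tl v))).
Proof.
  intros H; eapply Comp_ext; [apply (Comp_subst n 2 []); [exact H|constructor]|].
  intros [|x [|y v]] Hv; reflexivity.
Qed.

Lemma Comp_mul n f g : Comp n f -> Comp n g -> Comp n (fun v => f v * g v).
Proof.
  intros Hf Hg; eapply Comp_ext;
    [apply (Comp_nat_rect n g (fun _ => 0) (fun _ r v => r + f v)); auto using Comp_const|].
  - apply Comp_add; [apply Comp_nth|apply Comp_tl2; auto].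
  - intros v _; simpl; induction (g v); simpl; lia.
Qed.

Lemma Comp_pow n f g : Comp n f -> Comp n g -> Comp n (fun v => f v ^ g v).
Proof.
  intros Hf Hg; eapply Comp_ext;
    [apply (Comp_nat_rect n g (fun _ => 1) (fun _ r v => r * f v)); auto using Comp_const|].
  - apply Comp_mul; [apply Comp_nth|apply Comp_tl2; auto].
  - intros v _; simpl; induction (g v); simpl; lia.
Qed.

Lemma Comp_sum n b F :
  Comp n b -> Comp (S n) (fun v => F (nth 0 v 0) (tl v)) ->
  Comp n (fun v => sum (b v) (fun i => F i v)).
Proof.
  intros Hb HF; eapply Comp_ext;
    [apply (Comp_nat_rect n b (fun _ => 0) (fun i r v => r + F i v)); auto using Comp_const|].
  - apply Comp_add; [apply Comp_nth|apply Comp_weaken2 in HF; exact HF].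
  - intros v _; simpl; induction (b v); simpl; lia.
Qed.

Lemma CompB_leb n f g : Comp n f -> Comp n g -> CompB n (fun v => f v <=? g v).
Proof.
  (* With truncated subtraction, [1 - (f v - g v)] is the indicator of the inequality. *)
  intros Hf Hg; eapply Comp_ext;
    [apply (Comp_sub n (fun _ => 1) (fun v => f v - g v)); auto using Comp_const, Comp_sub|].
  intros v _; destruct (f v <=? g v) eqn:E; cbn [Nat.b2n];
    [apply Nat.leb_le in E|apply Nat.leb_gt in E]; lia.
Qed.

Lemma CompB_ltb n f g : Comp n f -> Comp n g -> CompB n (fun v => f v <? g v).
Proof. intros; apply CompB_leb; auto using Comp_S. Qed.

Lemma CompB_and n f g : CompB n f -> CompB n g -> CompB n (fun v => f v && g v).
Proof.
  intros Hf Hg; eapply Comp_ext; [apply Comp_mul; [exact Hf|exact Hg]|].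
  intros v _; simpl; destruct (f v), (g v); reflexivity.
Qed.

Lemma CompB_neg n f : CompB n f -> CompB n (fun v => negb (f v)).
Proof.
  intros Hf; eapply Comp_ext; [apply Comp_sub; [apply (Comp_const n 1)|exact Hf]|].
  intros v _; simpl; destruct (f v); reflexivity.
Qed.

Lemma CompB_eqb n f g : Comp n f -> Comp n g -> CompB n (fun v => f v =? g v).
Proof.
  intros Hf Hg; eapply Comp_ext;
    [apply (CompB_and n (fun v => f v <=? g v) (fun v => g v <=? f v)); auto using CompB_leb|].
  intros v _; cbv beta; f_equal; apply eq_iff_eq_true.
  rewrite andb_true_iff, !Nat.leb_le, Nat.eqb_eq; lia.
Qed.

Lemma Comp_cnt n b F :
  Comp n b -> CompB (S n) (fun v => F (nth 0 v 0) (tl v)) ->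
  Comp n (fun v => cnt (b v) (fun i => F i v)).
Proof. intros Hb HF; apply (Comp_sum n b (fun i v => Nat.b2n (F i v))); auto. Qed.

Lemma CompB_bex n b F :
  Comp n b -> CompB (S n) (fun v => F (nth 0 v 0) (tl v)) ->
  CompB n (fun v => bex (b v) (fun i => F i v)).
Proof. intros Hb HF; apply CompB_ltb; auto using Comp_const, Comp_cnt. Qed.

(** A quotient counts the positive multiples of [y] up to [x], so division reduces to bounded
    counting. *)
Lemma cnt_div x y : 0 < y -> cnt x (fun i => S i * y <=? x) = x / y.
Proof.
  intros Hy.
  assert (forall n, cnt n (fun i => S i * y <=? x) = Nat.min n (x / y)) as H.
  { induction n as [|n IH]; [reflexivity|].
    unfold cnt in *; cbn [sum]; rewrite IH.
    destruct (S n * y <=? x) eqn:E; cbn [Nat.b2n].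
    - apply Nat.leb_le in E.
      assert (S n <= x / y) by (apply Nat.div_le_lower_bound; nia); lia.
    - apply Nat.leb_gt in E.
      assert (x / y < S n) by (apply Nat.Div0.div_lt_upper_bound; nia); lia. }
  rewrite H; apply Nat.min_r, Nat.Div0.div_le_upper_bound; nia.
Qed.

Lemma Comp_div n f g : Comp n f -> Comp n g -> Comp n (fun v => f v / g v).
Proof.
  intros Hf Hg.
  assert (C2 : Comp 2 (fun v => cnt (nth 0 v 0) (fun i => S i * nth 1 v 0 <=? nth 0 v 0))).
  { apply Comp_cnt; [apply Comp_nth|]; apply CompB_leb; [apply Comp_mul; [apply Comp_S|]|];
      apply Comp_proj; auto using Shift_id, Shift_tl. }
  (* The indicator factor handles division by 0, which returns 0, whereas the count would be
     [f v]. *)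
  eapply Comp_ext;
    [apply (Comp_mul n (fun v => Nat.b2n (0 <? g v)) (fun v => cnt (f v) (fun i => S i * g v <=? f v)))|].
  - apply CompB_ltb; auto using Comp_const.
  - eapply Comp_ext; [apply (Comp_compose n 2 _ [f; g] C2); auto|]; reflexivity.
  - intros v _; cbv beta; destruct (g v) as [|y]; [reflexivity|].
    rewrite cnt_div by lia; change (0 <? S y) with true; cbn [Nat.b2n]; lia.
Qed.

Lemma Comp_mod n f g : Comp n f -> Comp n g -> Comp n (fun v => f v mod g v).
Proof.
  intros Hf Hg; eapply Comp_ext;
    [apply (Comp_sub n f (fun v => g v * (f v / g v))); auto using Comp_mul, Comp_div|].
  intros v _; rewrite Nat.Div0.mod_eq; auto.
Qed.

(* [ComputableN F] packages computability of a curried function so that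
   [ComputableN_app] can be used under the binders of [sum], [cnt] and [bex]. *)
Definition Computable1 (F : nat -> nat) := Comp 1 (fun v => F (nth 0 v 0)).
Definition Computable2 (F : nat -> nat -> nat) := Comp 2 (fun v => F (nth 0 v 0) (nth 1 v 0)).
Definition Computable3 (F : nat -> nat -> nat -> nat) :=
  Comp 3 (fun v => F (nth 0 v 0) (nth 1 v 0) (nth 2 v 0)).
Definition Decidable2 (F : nat -> nat -> bool) :=
  CompB 2 (fun v => F (nth 0 v 0) (nth 1 v 0)).
Definition Decidable4 (F : nat -> nat -> nat -> nat -> bool) :=
  CompB 4 (fun v => F (nth 0 v 0) (nth 1 v 0) (nth 2 v 0) (nth 3 v 0)).
Definition Computable5 (F : nat -> nat -> nat -> nat -> nat -> nat) :=
  Comp 5 (fun v => F (nth 0 v 0) (nth 1 v 0) (nth 2 v 0) (nth 3 v 0) (nth 4 v 0)).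
Definition Decidable5 (F : nat -> nat -> nat -> nat -> nat -> bool) :=
  CompB 5 (fun v => F (nth 0 v 0) (nth 1 v 0) (nth 2 v 0) (nth 3 v 0) (nth 4 v 0)).

Lemma Computable1_app F n a : Computable1 F -> Comp n a -> Comp n (fun v => F (a v)).
Proof. intros HF Ha; apply (Comp_compose n 1 _ [a] HF); auto. Qed.

Lemma Computable2_app F n a b :
  Computable2 F -> Comp n a -> Comp n b -> Comp n (fun v => F (a v) (b v)).
Proof. intros HF Ha Hb; apply (Comp_compose n 2 _ [a; b] HF); auto. Qed.

Lemma Computable3_app F n a b c :
  Computable3 F -> Comp n a -> Comp n b -> Comp n c -> Comp n (fun v => F (a v) (b v) (c v)).
Proof. intros HF Ha Hb Hc; apply (Comp_compose n 3 _ [a; b; c] HF); auto. Qed.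

Lemma Computable5_app F n a b c d e :
  Computable5 F -> Comp n a -> Comp n b -> Comp n c -> Comp n d -> Comp n e ->
  Comp n (fun v => F (a v) (b v) (c v) (d v) (e v)).
Proof. intros HF Ha Hb Hc Hd He; apply (Comp_compose n 5 _ [a; b; c; d; e] HF); auto 7. Qed.

Lemma Decidable2_app F n a b :
  Decidable2 F -> Comp n a -> Comp n b -> CompB n (fun v => F (a v) (b v)).
Proof. intros HF Ha Hb; apply (Comp_compose n 2 _ [a; b] HF); auto. Qed.

Lemma Decidable4_app F n a b c d :
  Decidable4 F -> Comp n a -> Comp n b -> Comp n c -> Comp n d ->
  CompB n (fun v => F (a v) (b v) (c v) (d v)).
Proof. intros HF Ha Hb Hc Hd; apply (Comp_compose n 4 _ [a; b; c; d] HF); auto 6. Qed.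

Lemma Decidable5_app F n a b c d e :
  Decidable5 F -> Comp n a -> Comp n b -> Comp n c -> Comp n d -> Comp n e ->
  CompB n (fun v => F (a v) (b v) (c v) (d v) (e v)).
Proof. intros HF Ha Hb Hc Hd He; apply (Comp_compose n 5 _ [a; b; c; d; e] HF); auto 7. Qed.

Ltac computable_step :=
  cbv beta;
  match goal with
  | H : ?F |- ?F => exact H
  | |- Shift (fun v => v) => exact Shift_id
  | |- Shift (@tl nat) => exact (Shift_tl _ Shift_id)
  | |- Shift (fun v => tl _) => apply Shift_tl
  | |- Comp _ (fun v => ?c) => apply Comp_const
  | |- Comp _ (fun v => nth _ _ 0) => apply Comp_proj
  | |- Comp _ (fun v => S _) => apply Comp_S
  | |- Comp _ (fun v => pred _) => apply Comp_pred
  | |- Comp _ (fun v => _ + _) => apply Comp_add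
  | |- Comp _ (fun v => _ - _) => apply Comp_sub
  | |- Comp _ (fun v => _ * _) => apply Comp_mul
  | |- Comp _ (fun v => _ ^ _) => apply Comp_pow
  | |- Comp _ (fun v => _ / _) => apply Comp_div
  | |- Comp _ (fun v => _ mod _) => apply Comp_mod
  | |- Comp _ (fun v => sum _ _) => apply Comp_sum
  | |- Comp _ (fun v => cnt _ _) => apply Comp_cnt
  | |- Comp _ (fun v => Nat.b2n _) => apply Comp_b2n
  | |- CompB _ (fun v => bex _ _) => apply CompB_bex
  | |- CompB _ (fun v => _ && _) => apply CompB_and
  | |- CompB _ (fun v => negb _) => apply CompB_neg
  | |- CompB _ (fun v => _ <=? _) => apply CompB_leb
  | |- CompB _ (fun v => _ <? _) => apply CompB_ltb
  | |- CompB _ (fun v => _ =? _) => apply CompB_eqb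
  | H : Computable1 ?F |- Comp _ (fun v => ?F _) => apply (Computable1_app F); [exact H|]
  | H : Computable2 ?F |- Comp _ (fun v => ?F _ _) => apply (Computable2_app F); [exact H| |]
  | H : Computable3 ?F |- Comp _ (fun v => ?F _ _ _) => apply (Computable3_app F); [exact H| | |]
  | H : Computable5 ?F |- Comp _ (fun v => ?F _ _ _ _ _) =>
      apply (Computable5_app F); [exact H| | | | |]
  | H : Decidable2 ?F |- CompB _ (fun v => ?F _ _) => apply (Decidable2_app F); [exact H| |]
  | H : Decidable4 ?F |- CompB _ (fun v => ?F _ _ _ _) =>
      apply (Decidable4_app F); [exact H| | | |]
  | H : Decidable5 ?F |- CompB _ (fun v => ?F _ _ _ _ _) =>
      apply (Decidable5_app F); [exact H| | | | |]
  end.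
Ltac computable := repeat computable_step.

(** * Fuel-bounded evaluation of a fixed program *)

Definition opt_code (o : option nat) : nat := match o with None => 0 | Some x => S x end.

(** The generated principle has no induction hypothesis for the programs inside the list of
    [PComp]. *)
Lemma PR_nested_ind (P : PR -> Prop) :
  P PZero -> P PSucc -> (forall i, P (PProj i)) ->
  (forall f gs, P f -> Forall P gs -> P (PComp f gs)) ->
  (forall f g, P f -> P g -> P (PRec f g)) -> (forall f, P f -> P (PMu f)) ->
  forall e, P e.
Proof.
  intros H0 H1 H2 H3 H4 H5; fix IH 1; intros [| |i|f gs|f g|f].
  - exact H0.
  - exact H1.
  - apply H2.
  - apply H3; [apply IH|]; induction gs; constructor; auto.
  - apply H4; apply IH.
  - apply H5; apply IH.
Qed.

(** A product of indicators replaces the case analysis: it vanishes as soon as one component is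
    undefined, whatever the last factor then is. *)
Lemma opt_list_code (F : PR -> option nat) gs h :
  opt_code (match opt_list F gs with Some vs => h vs | None => None end) =
  fold_right (fun g acc => Nat.b2n (0 <? opt_code (F g)) * acc) 1 gs *
  opt_code (h (map (fun g => pred (opt_code (F g))) gs)).
Proof.
  revert h; induction gs as [|g gs IH]; intros h; [simpl; lia|].
  cbn [opt_list fold_right map].
  destruct (F g) as [x|]; [|reflexivity].
  specialize (IH (fun vs => h (x :: vs))); cbn [opt_code] in *.
  change (0 <? S x) with true; cbn [Nat.b2n pred]; rewrite Nat.mul_1_l, <- IH.
  destruct (opt_list F gs); reflexivity.
Qed.

Lemma opt_rec_code b s m :
  opt_code (opt_rec b s m) =
  nat_rect (fun _ => nat) (opt_code b)
    (fun i r => match r with 0 => 0 | S r' => opt_code (s i r') end) m.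
Proof.
  induction m as [|m IH]; simpl; auto; rewrite <- IH; destruct (opt_rec b s m); auto.
Qed.

(* State of the search after [m] trials: 0 while it runs, 1 once it is stuck,
   [y + 2] once it has found [y]. *)
Definition search_state (F : nat -> option nat) : nat -> nat :=
  nat_rect (fun _ => nat) 0
    (fun i r => match r with
     | 0 => match opt_code (F i) with 0 => 1 | S x => match x with 0 => S (S i) | S _ => 0 end end
     | S r' => S r' end).

Lemma search_state_stop F y c s : search_state F y = S s -> search_state F (c + y) = S s.
Proof. intros H; induction c as [|c IH]; auto; simpl; fold (search_state F (c + y)); rewrite IH; auto. Qed.

Lemma opt_search_code F c y : search_state F y = 0 ->
  opt_code (opt_search F c y) = pred (search_state F (c + y)).
Proof.
  revert y; induction c as [|c IH]; intros y Hy; [simpl; rewrite Hy; auto|].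
  replace (S c + y) with (c + S y) by lia.
  assert (E : search_state F (S y) = match opt_code (F y) with 0 => 1
    | S x => match x with 0 => S (S y) | S _ => 0 end end).
  { simpl; fold (search_state F y); rewrite Hy; auto. }
  cbn [opt_search]; destruct (F y) as [[|x]|]; cbn [opt_code] in *.
  - rewrite (search_state_stop _ _ _ _ E); auto.
  - apply IH; auto.
  - rewrite (search_state_stop _ _ _ _ E); auto.
Qed.

(** Fuel 0 has code 0, so only positive fuel remains, where [eval] unfolds. The case split puts the
    predecessor of the fuel in front of the fuel, hence [tl (tl v)] for the arguments. *)
Lemma Comp_eval_succ e n :
  Comp (S (S n)) (fun v => opt_code (eval (S (nth 0 v 0)) e (tl (tl v)))) ->
  Comp (S n) (fun v => opt_code (eval (nth 0 v 0) e (tl v))).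
Proof.
  intros H; apply Comp_ext with (f := fun v => match nth 0 v 0 with 0 => 0
    | S k => opt_code (eval (S k) e (tl v)) end).
  - apply (Comp_match _ _ _ (fun k v => opt_code (eval (S k) e (tl v)))); computable.
  - intros v _; destruct (nth 0 v 0); reflexivity.
Qed.

(** Induction on the fixed program [e]: each program gets its own clocked evaluator, and programs
    are not coded as numbers. *)
Lemma Comp_eval e n : Comp (S n) (fun v => opt_code (eval (nth 0 v 0) e (tl v))).
Proof.
  revert n; induction e as [| |i|f gs IHf IHgs|f g IHf IHg|f IHf] using PR_nested_ind; intros n;
    apply Comp_eval_succ.
  - apply (Comp_const _ 1).
  - eapply Comp_ext; [apply (Comp_S _ (fun v => S (nth 2 v 0))), Comp_S, Comp_nth|].
    intros [|x [|y [|z v]]] _; reflexivity.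
  - apply (Comp_S _ (fun v => nth i (tl (tl v)) 0)); computable.
  - assert (HE : forall g, (forall n, Comp (S n) (fun v => opt_code (eval (nth 0 v 0) g (tl v)))) ->
      Comp (S (S n)) (fun v => opt_code (eval (nth 0 v 0) g (tl (tl v))))).
    { intros g Hg; exact (Comp_weaken2 n _ (Hg n)). }
    eapply Comp_ext; [apply Comp_mul with
      (f := fun v => fold_right (fun g acc => Nat.b2n (0 <?
        opt_code (eval (nth 0 v 0) g (tl (tl v)))) * acc) 1 gs)
      (g := fun v => opt_code (eval (nth 0 v 0) f
        (map (fun g => pred (opt_code (eval (nth 0 v 0) g (tl (tl v))))) gs)))|].
    + clear IHf; induction IHgs as [|g gs Hg _ IH]; cbn [fold_right]; [apply Comp_const|].
      apply Comp_mul; [|exact IH].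
      apply CompB_ltb; [apply Comp_const|apply HE, Hg].
    + eapply Comp_ext; [apply (Comp_compose _ (S (length gs)) _ ((fun v => nth 0 v 0) ::
        map (fun g v => pred (opt_code (eval (nth 0 v 0) g (tl (tl v))))) gs) (IHf (length gs)))|].
      * constructor; [apply Comp_nth|]; apply Forall_map; revert IHgs; apply Forall_impl.
        intros g Hg; apply Comp_pred, HE, Hg.
      * simpl; rewrite length_map; auto.
      * intros v _; simpl; rewrite map_map; auto.
    + intros v _; rewrite eval_comp, opt_list_code; auto.
  (* On an empty argument list [hd] defaults to 0, so the recursion stops at its base. *)
  - destruct n as [|n].
    + eapply Comp_ext; [exact (Comp_weaken2 0 _ (IHf 0))|].
      intros [|k [|y [|]]] Hv; try discriminate; rewrite eval_rec; reflexivity.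
    + eapply Comp_ext; [apply (Comp_nat_rect (S (S (S n))) (fun v => nth 2 v 0)
        (fun v => opt_code (eval (nth 0 v 0) f (tl (tl (tl v)))))
        (fun i r v => match r with 0 => 0
           | S r' => opt_code (eval (nth 0 v 0) g (i :: r' :: tl (tl (tl v)))) end))|].
      * apply Comp_nth.
      * eapply Comp_ext; [apply (Comp_subst n 3 [fun v => nth 0 v 0]
          (fun v => opt_code (eval (nth 0 v 0) f (tl v)))); [apply IHf|repeat constructor; apply Comp_nth]|].
        intros [|x [|y [|z v]]] Hv; try discriminate; reflexivity.
      * apply (Comp_match _ _ _ (fun r' v => opt_code (eval (nth 0 (tl (tl v)) 0) g
          (nth 0 v 0 :: r' :: tl (tl (tl (tl (tl v)))))))); computable.
        eapply Comp_ext; [apply (Comp_subst n 6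
          [fun v => nth 3 v 0; fun v => nth 1 v 0; fun v => nth 0 v 0]
          (fun v => opt_code (eval (nth 0 v 0) g (tl v)))); [apply IHg|repeat constructor; apply Comp_nth]|].
        intros [|x0 [|x1 [|x2 [|x3 [|x4 [|x5 v]]]]]] Hv; try discriminate; reflexivity.
      * intros [|x [|y [|z v]]] Hv; try discriminate.
        rewrite eval_rec, opt_rec_code; reflexivity.
  - apply Comp_ext with (f := fun v => pred (search_state
      (fun y => eval (nth 0 v 0) f (y :: tl (tl v))) (nth 0 v 0))).
    + apply Comp_pred; unfold search_state.
      set (G := fun i r v => match r with
        | 0 => match opt_code (eval (nth 0 v 0) f (i :: tl (tl v))) with
               | 0 => 1 | S x => match x with 0 => S (S i) | S _ => 0 end end
        | S r' => S r' end).
      apply (Comp_nat_rect (S (S n)) (fun v => nth 0 v 0) (fun _ => 0) G); computable.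
      unfold G.
      apply (Comp_match _ (fun v => nth 1 v 0) (fun v => match opt_code (eval (nth 0 (tl (tl v)) 0) f
          (nth 0 v 0 :: tl (tl (tl (tl v))))) with
               | 0 => 1 | S x => match x with 0 => S (S (nth 0 v 0)) | S _ => 0 end end)
        (fun r' _ => S r')); computable.
      apply (Comp_match _ _ _ (fun x v => match x with 0 => S (S (nth 0 v 0)) | S _ => 0 end));
        computable.
      * eapply Comp_ext; [apply (Comp_subst n 4 [fun v => nth 2 v 0; fun v => nth 0 v 0]
          (fun v => opt_code (eval (nth 0 v 0) f (tl v)))); [apply IHf|repeat constructor; apply Comp_nth]|].
        intros [|x0 [|x1 [|x2 [|x3 v]]]] Hv; try discriminate; reflexivity.
      * apply (Comp_match _ (fun v => nth 0 v 0) (fun v => S (S (nth 0 (tl v) 0))) (fun _ _ => 0)); computable.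
    + intros v _; rewrite eval_mu, opt_search_code; auto; rewrite Nat.add_0_r; auto.
Qed.

(** * Finite sums and counting *)

Lemma sum_ext n f g : (forall i, i < n -> f i = g i) -> sum n f = sum n g.
Proof. induction n as [|n IH]; simpl; intros H; auto; rewrite IH, H; auto. Qed.

Lemma sum_le n f g : (forall i, i < n -> f i <= g i) -> sum n f <= sum n g.
Proof.
  induction n as [|n IH]; simpl; intros H; auto.
  apply Nat.add_le_mono; [apply IH; auto|apply H; auto].
Qed.

Lemma sum_add n f g : sum n (fun i => f i + g i) = sum n f + sum n g.
Proof. induction n as [|n IH]; simpl; auto; rewrite IH; lia. Qed.

Lemma sum_mul n c f : sum n (fun i => c * f i) = c * sum n f.
Proof. induction n as [|n IH]; simpl; [lia|]; rewrite IH; lia. Qed.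

Lemma sum_const n c : sum n (fun _ => c) = n * c.
Proof. induction n as [|n IH]; simpl; auto; rewrite IH; lia. Qed.

Lemma sum_swap n m f : sum n (fun i => sum m (f i)) = sum m (fun j => sum n (fun i => f i j)).
Proof.
  induction n as [|n IH]; simpl.
  - rewrite sum_const; lia.
  - rewrite IH, <- sum_add; auto.
Qed.

Lemma cnt_filter n P : cnt n P = length (filter P (seq 0 n)).
Proof.
  unfold cnt; induction n as [|n IH]; auto.
  rewrite seq_S, filter_app, length_app, <- IH; simpl; destruct (P n); auto.
Qed.

Lemma cnt_ext n P Q : (forall i, i < n -> P i = Q i) -> cnt n P = cnt n Q.
Proof. intros H; apply sum_ext; intros; rewrite H; auto. Qed.

Lemma cnt_le n P Q : (forall i, i < n -> P i = true -> Q i = true) -> cnt n P <= cnt n Q.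
Proof.
  intros H; apply sum_le; intros i Hi; specialize (H i Hi).
  destruct (P i), (Q i); simpl; auto; discriminate H; auto.
Qed.

Lemma bex_spec n P : bex n P = true <-> exists i, i < n /\ P i = true.
Proof.
  unfold bex; rewrite Nat.ltb_lt, cnt_filter; split.
  - destruct (filter P (seq 0 n)) as [|i l] eqn:E; simpl; [lia|intros _].
    assert (H : In i (filter P (seq 0 n))) by (rewrite E; left; auto).
    apply filter_In in H; rewrite in_seq in H; exists i; split; [lia|tauto].
  - intros (i & Hi & HP).
    assert (H : In i (filter P (seq 0 n))) by (apply filter_In; rewrite in_seq; split; [lia|auto]).
    destruct (filter P (seq 0 n)); [destruct H|simpl; lia].
Qed.

(** * Sums over lists and averaging *)

Definition lsum {A} (f : A -> nat) (l : list A) : nat := fold_right (fun x s => f x + s) 0 l.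

Lemma lsum_app {A} f (l l' : list A) : lsum f (l ++ l') = lsum f l + lsum f l'.
Proof. induction l; simpl; lia. Qed.

Lemma lsum_le {A} f g (l : list A) : (forall x, In x l -> f x <= g x) -> lsum f l <= lsum g l.
Proof. induction l as [|x l IH]; simpl; intros H; auto; apply Nat.add_le_mono; auto. Qed.

Lemma lsum_ext {A} f g (l : list A) : (forall x, In x l -> f x = g x) -> lsum f l = lsum g l.
Proof. induction l as [|x l IH]; simpl; intros H; auto. Qed.

Lemma lsum_mul {A} c f (l : list A) : lsum (fun x => c * f x) l = c * lsum f l.
Proof. induction l as [|x l IH]; simpl; [lia|]; rewrite IH; lia. Qed.

Lemma lsum_const {A} c (l : list A) : lsum (fun _ => c) l = length l * c.
Proof. induction l as [|x l IH]; simpl; auto. Qed.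

Lemma lsum_add {A} f g (l : list A) : lsum (fun x => f x + g x) l = lsum f l + lsum g l.
Proof. induction l as [|x l IH]; simpl; auto; rewrite IH; lia. Qed.

Lemma lsum_swap {A B} (f : A -> B -> nat) (l : list A) (l' : list B) :
  lsum (fun x => lsum (f x) l') l = lsum (fun y => lsum (fun x => f x y) l) l'.
Proof.
  induction l as [|x l IH]; simpl.
  - rewrite lsum_const; lia.
  - rewrite IH, <- lsum_add; auto.
Qed.

Lemma lsum_filter {A} (P : A -> bool) (l : list A) :
  lsum (fun x => Nat.b2n (P x)) l = length (filter P l).
Proof. induction l as [|x l IH]; simpl; auto; rewrite IH; destruct (P x); auto. Qed.

Lemma lsum_average {A} (f : A -> nat) (l : list A) c :
  l <> [] -> lsum f l <= length l * c -> exists x, In x l /\ f x <= c.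
Proof.
  intros Hl H.
  destruct (classic (exists x, In x l /\ f x <= c)) as [|Hn]; auto.
  assert (lsum (fun _ => S c) l <= lsum f l) as H'.
  { apply lsum_le; intros x Hx; destruct (le_lt_dec (f x) c); [|lia].
    destruct Hn; eauto. }
  rewrite lsum_const in H'; destruct l; [tauto|simpl in *; nia].
Qed.

(** * Dispersers *)

(** Serves for the rows of a table and, repetitions being allowed, for the sets of at most [n]
    values. *)
Fixpoint tuples (M n : nat) : list (list nat) :=
  match n with
  | 0 => [[]]
  | S n => flat_map (fun x => map (cons x) (tuples M n)) (seq 0 M)
  end.

Definition lprod (w : nat -> nat) (l : list nat) : nat := fold_right (fun x s => w x * s) 1 l.

Lemma lsum_map {A B} (f : B -> nat) (g : A -> B) l : lsum f (map g l) = lsum (fun x => f (g x)) l.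
Proof. induction l; simpl; auto. Qed.

Lemma lsum_flat_map {A B} (f : B -> nat) (g : A -> list B) l :
  lsum f (flat_map g l) = lsum (fun x => lsum f (g x)) l.
Proof. induction l; simpl; auto; rewrite lsum_app; auto. Qed.

(** The power of a sum, multiplied out; in counting form, the expectation of a product of
    independent factors. *)
Lemma lsum_tuples M n w : lsum (lprod w) (tuples M n) = lsum w (seq 0 M) ^ n.
Proof.
  induction n as [|n IH]; [reflexivity|].
  cbn [tuples]; rewrite lsum_flat_map.
  rewrite lsum_ext with (g := fun x => lsum w (seq 0 M) ^ n * w x).
  - rewrite lsum_mul; cbn [Nat.pow]; lia.
  - intros x _; rewrite lsum_map; cbn [lprod fold_right].
    change (lsum (fun l => w x * lprod w l) (tuples M n) = lsum w (seq 0 M) ^ n * w x).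
    rewrite lsum_mul, IH; lia.
Qed.

Lemma length_tuples M n : length (tuples M n) = M ^ n.
Proof.
  pose proof (lsum_tuples M n (fun _ => 1)) as H.
  rewrite lsum_const, length_seq, Nat.mul_1_r in H; rewrite <- H.
  rewrite lsum_ext with (g := fun _ => 1); [rewrite lsum_const; lia|].
  intros l _; induction l; simpl in *; lia.
Qed.

Lemma in_tuples M n l : In l (tuples M n) <-> length l = n /\ forall x, In x l -> x < M.
Proof.
  revert l; induction n as [|n IH]; intros l; cbn [tuples].
  - split.
    + intros [<-|[]]; split; auto; intros x [].
    + intros [Hl _]; destruct l; [left; auto|discriminate].
  - rewrite in_flat_map; split.
    + intros (x & Hx & Hl); apply in_seq in Hx; apply in_map_iff in Hl.
      destruct Hl as (l' & <- & Hl'); apply IH in Hl'; simpl; split; [lia|].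
      intros y [<-|Hy]; [lia|]; apply Hl'; auto.
    + intros [Hl HM]; destruct l as [|x l]; [discriminate|]; exists x; split.
      * apply in_seq; split; [lia|]; apply HM; left; auto.
      * apply in_map_iff; exists l; split; auto; apply IH; split.
        { simpl in Hl; lia. }
        { intros; apply HM; right; auto. }
Qed.

Definition memb (B : list nat) (x : nat) : bool := existsb (Nat.eqb x) B.

Lemma memb_spec B x : memb B x = true <-> In x B.
Proof.
  unfold memb; rewrite existsb_exists; split.
  - intros (y & Hy & E); apply Nat.eqb_eq in E; subst; auto.
  - intros H; exists x; split; auto; apply Nat.eqb_refl.
Qed.

Definition heavy_row (D : nat) (B row : list nat) : bool := D <=? length (filter (memb B) row).

(* Markov's inequality for the weight [8 ^ hits]. *)
Lemma heavy_rows_few M D B : 7 * length B <= M ->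
  2 ^ D * length (filter (heavy_row D B) (tuples M (2 * D))) <= M ^ (2 * D).
Proof.
  intros HB.
  set (w := fun x => if memb B x then 8 else 1).
  assert (Hw : forall l, lprod w l = 8 ^ length (filter (memb B) l)).
  { induction l as [|x l IH]; [reflexivity|].
    cbn [lprod fold_right filter]; change (fold_right _ _ l) with (lprod w l); rewrite IH.
    unfold w; destruct (memb B x); cbn [length Nat.pow]; lia. }
  (* As 8 = 1 + 7, the bound on [B] keeps the mean weight of an entry at most 2. Then [8 ^ D]
     against [2 ^ (2 * D) = 4 ^ D] leaves the gain [2 ^ D]. *)
  assert (H1 : lsum w (seq 0 M) <= 2 * M).
  { rewrite lsum_ext with (g := fun x => 1 + 7 * Nat.b2n (memb B x))
      by (intros x _; unfold w; destruct (memb B x); reflexivity).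
    rewrite lsum_add, lsum_mul, lsum_const, lsum_filter, length_seq.
    assert (length (filter (memb B) (seq 0 M)) <= length B); [|lia].
    apply NoDup_incl_length; [apply NoDup_filter, seq_NoDup|].
    intros x Hx; apply filter_In in Hx; apply memb_spec; tauto. }
  assert (H2 : 8 ^ D * length (filter (heavy_row D B) (tuples M (2 * D))) <= (2 * M) ^ (2 * D)).
  { etransitivity; [|apply Nat.pow_le_mono_l; exact H1].
    rewrite <- lsum_tuples, <- lsum_filter, <- lsum_mul.
    apply lsum_le; intros l _; rewrite Hw; unfold heavy_row.
    destruct (D <=? _) eqn:E; cbn [Nat.b2n]; [|lia].
    apply Nat.leb_le in E; rewrite Nat.mul_1_r; apply Nat.pow_le_mono_r; lia. }
  rewrite Nat.pow_mul_l, (Nat.pow_mul_r 2 2 D) in H2.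
  change 8 with (2 ^ 2 * 2) in H2; rewrite Nat.pow_mul_l in H2.
  pose proof (Nat.pow_nonzero (2 ^ 2) D ltac:(discriminate)).
  apply Nat.mul_le_mono_pos_l with (p := (2 ^ 2) ^ D); lia.
Qed.

Definition potential (lam D : nat) (Bs rows : list (list nat)) : nat :=
  lsum (fun B => lam ^ length (filter (heavy_row D B) rows)) Bs.

(** For each [B] a random row is heavy with probability at most [1 / 2 ^ D], so its term grows on
    average by a factor at most [1 + lam / 2 ^ D], hence at most [1 + 1 / (2 X)]. Some row does no
    worse than the average. *)
Lemma potential_step lam X M D Bs rows :
  0 < M -> lam * (2 * X) <= 2 ^ D -> (forall B, In B Bs -> 7 * length B <= M) ->
  exists row, In row (tuples M (2 * D)) /\
    2 * X * potential lam D Bs (row :: rows) <= (2 * X + 1) * potential lam D Bs rows.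
Proof.
  intros HM Hlam HB.
  set (Q := M ^ (2 * D)).
  assert (Hlen : length (tuples M (2 * D)) = Q) by apply length_tuples.
  apply lsum_average.
  - intros E; rewrite E in Hlen; unfold Q in Hlen; simpl length in Hlen.
    symmetry in Hlen; revert Hlen; apply Nat.pow_nonzero; lia.
  - rewrite Hlen, lsum_mul; unfold potential.
    rewrite lsum_swap, <- lsum_mul, <- lsum_mul, <- lsum_mul.
    apply lsum_le; intros B HBs; specialize (HB B HBs).
    pose proof (heavy_rows_few M D B HB) as Hq; fold Q in Hq.
    set (c := lam ^ length (filter (heavy_row D B) rows)).
    assert (lsum (fun row => lam ^ length (filter (heavy_row D B) (row :: rows))) (tuples M (2 * D))
      <= c * (Q + lam * length (filter (heavy_row D B) (tuples M (2 * D))))) as H1.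
    { rewrite <- lsum_filter, <- lsum_mul, <- Hlen, <- (Nat.mul_1_r (length _)), <- lsum_const.
      rewrite <- lsum_add, <- lsum_mul; apply lsum_le; intros row _.
      cbn [filter]; destruct (heavy_row D B row); cbn [Nat.b2n length Nat.pow]; fold c; lia. }
    set (q := length (filter _ (tuples M (2 * D)))) in *.
    assert (2 * X * (Q + lam * q) <= (2 * X + 1) * Q) as H2.
    { assert (2 * X * (lam * q) <= 2 ^ D * q) by (rewrite Nat.mul_assoc; apply Nat.mul_le_mono_r; lia); lia. }
    nia.
Qed.

(** The compound factor [(1 + 1 / (2 X)) ^ i] is bounded by [2 X / (2 X - i)], which keeps the
    induction linear and equals 2 at [i = X]. *)
Lemma potential_rows lam X M D Bs i :
  0 < M -> lam * (2 * X) <= 2 ^ D -> (forall B, In B Bs -> 7 * length B <= M) -> i <= X ->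
  exists rows, length rows = i /\ (forall row, In row rows -> In row (tuples M (2 * D))) /\
    (2 * X - i) * potential lam D Bs rows <= 2 * X * length Bs.
Proof.
  intros HM Hlam HB; induction i as [|i IH]; intros Hi.
  - exists []; split; [auto|split; [intros _ []|]].
    unfold potential; simpl filter; simpl length; rewrite lsum_const; simpl (lam ^ 0); lia.
  - destruct IH as (rows & Hl & Hrows & HW); [lia|].
    destruct (potential_step lam X M D Bs rows HM Hlam HB) as (row & Hrow & Hstep).
    exists (row :: rows); split; [simpl; auto|split; [intros r [<-|Hr]; auto|]].
    set (W := potential lam D Bs rows) in *; set (W' := potential lam D Bs (row :: rows)) in *.
    assert ((2 * X - S i) * (2 * X + 1) <= 2 * X * (2 * X - i)) as H1 by nia.
    assert (2 * X * ((2 * X - S i) * W') <= 2 * X * (2 * X * length Bs)) as H2.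
    { transitivity ((2 * X - S i) * ((2 * X + 1) * W)); [nia|].
      transitivity (2 * X * ((2 * X - i) * W)); nia. }
    apply Nat.mul_le_mono_pos_l in H2; lia.
Qed.

Lemma filter_cnt {A} (P : A -> bool) l d :
  length (filter P l) = cnt (length l) (fun i => P (nth i l d)).
Proof.
  induction l as [|x l IH] using rev_ind; [reflexivity|].
  rewrite filter_app, !length_app, Nat.add_1_r; unfold cnt in *; cbn [sum].
  rewrite nth_middle, IH; f_equal.
  - apply sum_ext; intros; rewrite app_nth1; auto.
  - simpl; destruct (P x); auto.
Qed.

(* The rows of [E] are chosen one by one so that the potential
   [sum_B (2 M) ^ (number of rows with half of their entries in B)] stays below twice its initial value. *)
Lemma disperser_exists X beta M D :
  2 <= M -> 7 * beta <= M -> 4 * M * X <= 2 ^ D ->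
  exists E : nat -> nat -> nat, (forall x t, E x t < M) /\
    forall B, length B = beta -> (forall y, In y B -> y < M) ->
      cnt X (fun x => D <=? cnt (2 * D) (fun t => memb B (E x t))) <= beta.
Proof.
  intros HM Hbeta HD.
  destruct (potential_rows (2 * M) X M D (tuples M beta) X) as (rows & Hl & Hrows & HW); auto.
  - lia.
  - lia.
  - intros B HB; apply in_tuples in HB; destruct HB as [-> _]; auto.
  - exists (fun x t => nth t (nth x rows []) 0); split.
    + intros x t; destruct (nth_in_or_default x rows []) as [Hx| ->].
      * apply Hrows, in_tuples in Hx; destruct Hx as [_ Hx].
        destruct (nth_in_or_default t (nth x rows []) 0) as [Ht| ->]; [auto|lia].
      * destruct t; simpl; lia.
    + intros B HB HBM.
      rewrite cnt_ext with (Q := fun x => heavy_row D B (nth x rows [])).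
      2:{ intros x Hx; unfold heavy_row.
          assert (In (nth x rows []) (tuples M (2 * D))) as H by (apply Hrows, nth_In; lia).
          apply in_tuples in H; destruct H as [H _].
          rewrite (filter_cnt _ _ 0), H; auto. }
      rewrite <- Hl, <- filter_cnt.
      set (h := length (filter (heavy_row D B) rows)).
      destruct (Nat.eq_dec X 0) as [HX|HX].
      { unfold h; rewrite HX in Hl; destruct rows; [simpl; lia|discriminate]. }
      (* The term of this [B] alone is at most twice the number [M ^ beta] of sets. With base
         [2 * M] this rules out [h > beta]. *)
      assert (Hh : (2 * M) ^ h <= 2 * M ^ beta).
      { rewrite length_tuples in HW.
        assert (potential (2 * M) D (tuples M beta) rows <= 2 * M ^ beta) as HW'.
        { replace (2 * X - X) with X in HW by lia.
          apply Nat.mul_le_mono_pos_l with (p := X); lia. }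
        etransitivity; [|exact HW'].
        assert (In B (tuples M beta)) as Hin by (apply in_tuples; auto).
        unfold potential; apply in_split in Hin; destruct Hin as (l1 & l2 & ->).
        rewrite lsum_app; unfold lsum at 2; cbn [fold_right]; fold h; lia. }
      destruct (le_lt_dec h beta) as [|Hlt]; auto; exfalso.
      assert ((2 * M) ^ S beta <= (2 * M) ^ h) as H1 by (apply Nat.pow_le_mono_r; lia).
      cbn [Nat.pow] in H1; rewrite Nat.pow_mul_l in H1.
      pose proof (Nat.pow_nonzero 2 beta ltac:(discriminate)).
      pose proof (Nat.pow_nonzero M beta ltac:(lia)).
      assert (M ^ beta <= 2 ^ beta * M ^ beta) by nia.
      assert (2 * M * M ^ beta <= 2 * M ^ beta) by nia.
      nia.
Qed.

(** * Cardinality bounds *)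

(** Stated through duplicate-free lists because it is applied to enumerable sets that may be
    undecidable. *)
Definition card_le (P : nat -> Prop) (n : nat) : Prop :=
  forall l, NoDup l -> (forall x, In x l -> P x) -> length l <= n.

Lemma card_le_impl (P Q : nat -> Prop) n m :
  card_le Q n -> (forall x, P x -> Q x) -> n <= m -> card_le P m.
Proof. intros H HPQ Hnm l Hl Hin; specialize (H l Hl); etransitivity; [apply H; auto|auto]. Qed.

Lemma card_le_or P Q n m : card_le P n -> card_le Q m -> card_le (fun x => P x \/ Q x) (n + m).
Proof.
  intros HP HQ l Hl Hin.
  set (p := fun x => if excluded_middle_informative (P x) then true else false).
  assert (Hp : forall x, p x = true <-> P x).
  { intros x; unfold p; destruct (excluded_middle_informative (P x)); split; auto; discriminate. }
  rewrite <- (filter_length p l).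
  apply Nat.add_le_mono; [apply HP|apply HQ]; try (apply NoDup_filter; auto); intros x Hx;
    apply filter_In in Hx; destruct Hx as [Hx Hpx].
  - apply Hp; auto.
  - destruct (Hin x Hx) as [HPx|]; auto; apply Hp in HPx; rewrite HPx in Hpx; discriminate.
Qed.

Lemma card_le_ex_lt n (P : nat -> nat -> Prop) m :
  (forall i, i < n -> card_le (P i) m) -> card_le (fun x => exists i, i < n /\ P i x) (n * m).
Proof.
  induction n as [|n IH]; intros H.
  - intros [|x l] _ Hin; auto; destruct (Hin x) as (i & Hi & _); [left; auto|lia].
  - apply card_le_impl with (Q := fun x => P n x \/ exists i, i < n /\ P i x) (n := m + n * m); auto.
    + apply card_le_or; [apply H; lia|apply IH; auto].
    + intros x (i & Hi & Hx); destruct (Nat.eq_dec i n) as [->|]; auto.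
      right; exists i; split; [lia|auto].
Qed.

Lemma card_le_functional (P : nat -> Prop) : (forall x y, P x -> P y -> x = y) -> card_le P 1.
Proof.
  intros H [|x [|y l]] Hl Hin; simpl; try lia.
  inversion Hl as [|? ? Hx _]; destruct Hx; left; apply H; apply Hin; simpl; auto.
Qed.

(** A finite list of members already lies in one stage. Comparability is asked in either direction,
    not growth in [w], to cover a guard that later fails. *)
Lemma card_le_chain (P : nat -> nat -> Prop) n :
  (forall w w', (forall x, P w x -> P w' x) \/ (forall x, P w' x -> P w x)) ->
  (forall w, card_le (P w) n) -> card_le (fun x => exists w, P w x) n.
Proof.
  intros Hc H l Hl Hin.
  assert (exists w, forall x, In x l -> P w x) as [w Hw].
  { clear Hl; induction l as [|x l IH]; [exists 0; intros _ []|].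
    destruct IH as [w Hw]; [intros; apply Hin; right; auto|].
    destruct (Hin x) as [w' Hw']; [left; auto|].
    destruct (Hc w w'); [exists w'|exists w]; intros y [<-|Hy]; auto. }
  apply (H w); auto.
Qed.

Lemma card_le_mono (P : nat -> nat -> Prop) n :
  (forall w w' x, w <= w' -> P w x -> P w' x) ->
  (forall w, card_le (P w) n) -> card_le (fun x => exists w, P w x) n.
Proof.
  intros Hm; apply card_le_chain; intros w w'.
  destruct (Nat.le_ge_cases w w'); [left|right]; intros x; apply Hm; auto.
Qed.

Lemma card_le_cnt n P : card_le (fun x => x < n /\ P x = true) (cnt n P).
Proof.
  intros l Hl Hin; rewrite cnt_filter; apply NoDup_incl_length; auto.
  intros x Hx; apply filter_In; rewrite in_seq; destruct (Hin x Hx); split; auto; lia.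
Qed.

Lemma cnt_le_card n P m : card_le (fun x => x < n /\ P x = true) m -> cnt n P <= m.
Proof.
  intros H; rewrite cnt_filter; apply H; [apply NoDup_filter, seq_NoDup|].
  intros x Hx; apply filter_In in Hx; rewrite in_seq in Hx; split; [lia|tauto].
Qed.

Lemma card_le_inj (f : nat -> nat) (P Q : nat -> Prop) n :
  card_le Q n -> (forall x, P x -> Q (f x)) ->
  (forall x y, P x -> P y -> f x = f y -> x = y) -> card_le P n.
Proof.
  intros H HPQ Hinj l Hl Hin; rewrite <- (length_map f); apply H.
  - apply NoDup_map_NoDup_ForallPairs; auto; intros x y Hx Hy; apply Hinj; auto.
  - intros y Hy; apply in_map_iff in Hy; destruct Hy as (x & <- & Hx); auto.
Qed.

(** Incidences counted twice: every listed [z] has at least [S L] of them, every [i] at most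
    [g i]. *)
Lemma card_le_double_count (R : nat -> nat -> bool) n L g :
  (forall i, i < n -> card_le (fun z => R z i = true) (g i)) ->
  forall l, NoDup l -> (forall z, In z l -> L < cnt n (R z)) -> length l * S L <= sum n g.
Proof.
  intros Hg l Hl Hin.
  assert (length l * S L <= sum n (fun i => length (filter (fun z => R z i) l))) as H.
  { clear Hl; induction l as [|z l IH]; [simpl; lia|].
    assert (sum n (fun i => length (filter (fun z => R z i) (z :: l))) =
      cnt n (R z) + sum n (fun i => length (filter (fun z => R z i) l))) as E.
    { unfold cnt; rewrite <- sum_add; apply sum_ext; intros i _; simpl; destruct (R z i); auto. }
    rewrite E; specialize (Hin z (or_introl eq_refl)) as Hz.
    assert (length l * S L <= sum n (fun i => length (filter (fun z => R z i) l))).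
    { apply IH; intros; apply Hin; right; auto. }
    simpl length; lia. }
  etransitivity; [exact H|]; apply sum_le; intros i Hi; apply Hg; auto.
  - apply NoDup_filter; auto.
  - intros z Hz; apply filter_In in Hz; tauto.
Qed.

(** * Codes of strings and pairs *)

Fixpoint pos_string (p : positive) : bstring :=
  match p with
  | xH => []
  | xO p => false :: pos_string p
  | xI p => true :: pos_string p
  end.

(** The string coded by [n] is the binary expansion of [n + 1], lowest digit first, without its
    leading 1. *)
Definition dec (n : nat) : bstring := pos_string (Pos.of_succ_nat n).

Lemma enc_dec n : enc (dec n) = n.
Proof.
  assert (H : forall p, S (enc (pos_string p)) = Pos.to_nat p).
  { induction p as [p IH|p IH|]; cbn [pos_string enc]; [| |reflexivity].
    - rewrite Pos2Nat.inj_xI, <- IH; lia.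
    - rewrite Pos2Nat.inj_xO, <- IH; lia. }
  specialize (H (Pos.of_succ_nat n)); rewrite SuccNat2Pos.id_succ in H; unfold dec; lia.
Qed.

Lemma enc_inj s s' : enc s = enc s' -> s = s'.
Proof.
  revert s'; induction s as [|b s IH]; intros [|b' s']; cbn [enc]; auto; intros H.
  - destruct b'; lia.
  - destruct b; lia.
  - destruct b, b'; try lia; f_equal; apply IH; lia.
Qed.

Lemma dec_enc s : dec (enc s) = s.
Proof. apply enc_inj, enc_dec. Qed.

Lemma enc_bounds s : 2 ^ length s <= enc s + 1 < 2 ^ S (length s).
Proof. induction s as [|b s IH]; [simpl; lia|]; cbn [enc length Nat.pow] in *; destruct b; lia. Qed.

(** Codes are ordered by length, so quantifying over programs shorter than [k] is a bounded
    quantifier over codes. *)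
Lemma length_lt_enc s k : length s < k <-> enc s < 2 ^ k - 1.
Proof.
  pose proof (enc_bounds s) as H; split; intros Hk.
  - assert (2 ^ S (length s) <= 2 ^ k) by (apply Nat.pow_le_mono_r; lia); lia.
  - destruct (le_lt_dec k (length s)) as [Hle|]; auto.
    apply (Nat.pow_le_mono_r 2) in Hle; lia.
Qed.

Lemma length_dec_le n k : n < 2 ^ k -> length (dec n) <= k.
Proof.
  intros H; cut (length (dec n) < S k); [lia|].
  apply length_lt_enc; rewrite enc_dec; cbn [Nat.pow]; lia.
Qed.

(** Chosen to agree with [pair_str] on codes, since a program receives a paired condition in exactly
    this form. *)
Definition npair (x y : nat) : nat := enc (pair_str (dec x) (dec y)).

Lemma npair_enc s t : npair (enc s) (enc t) = enc (pair_str s t).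
Proof. unfold npair; rewrite !dec_enc; auto. Qed.

Lemma length_pair_str s t : length (pair_str s t) = 2 * length s + 2 + length t.
Proof.
  unfold pair_str; rewrite !length_app.
  assert (length (flat_map (fun b : bool => [b; b]) s) = 2 * length s) as ->.
  { induction s; simpl in *; lia. }
  simpl; lia.
Qed.

Lemma pair_str_inj s t s' t' : pair_str s t = pair_str s' t' -> s = s' /\ t = t'.
Proof.
  unfold pair_str; revert s'; induction s as [|b s IH]; intros [|b' s']; simpl.
  - intros H; injection H; auto.
  - intros H; injection H as <- E; discriminate.
  - intros H; injection H as -> E; discriminate.
  - intros H; injection H as -> _ H; destruct (IH _ H); subst; auto.
Qed.

Lemma npair_inj x y x' y' : npair x y = npair x' y' -> x = x' /\ y = y'.
Proof.
  intros H; apply enc_inj, pair_str_inj in H; destruct H as [Hx Hy].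
  apply (f_equal enc) in Hx, Hy; rewrite !enc_dec in *; auto.
Qed.

Definition digit (x : nat) : nat := Nat.b2n (0 <? x) * (2 - x mod 2).
Definition drop_digits (i x : nat) : nat := nat_rect (fun _ => nat) x (fun _ r => pred r / 2) i.

Lemma enc_cons b s :
  enc (b :: s) = 2 * enc s + digit (enc (b :: s)) /\ 0 < digit (enc (b :: s)) /\
  pred (enc (b :: s)) / 2 = enc s.
Proof.
  unfold digit; cbn [enc]; destruct b.
  - replace (2 * enc s + 2) with (S (2 * enc s + 1)) by lia; cbn [Nat.ltb Nat.leb Nat.b2n pred].
    replace (S (2 * enc s + 1)) with (0 + (enc s + 1) * 2) by lia.
    rewrite Nat.Div0.mod_add, (Nat.mul_comm 2 (enc s)), Nat.div_add_l by lia.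
    change (0 mod 2) with 0; change (1 / 2) with 0; cbn; lia.
  - replace (2 * enc s + 1) with (S (2 * enc s)) by lia; cbn [Nat.ltb Nat.leb Nat.b2n pred].
    replace (S (2 * enc s)) with (1 + enc s * 2) by lia.
    rewrite Nat.Div0.mod_add, (Nat.mul_comm 2 (enc s)), Nat.div_mul by lia.
    change (1 mod 2) with 1; cbn; lia.
Qed.

Lemma drop_digits_nil i : drop_digits i 0 = 0.
Proof. induction i as [|i IH]; simpl; auto; fold (drop_digits i 0); rewrite IH; auto. Qed.

Lemma drop_digits_cons i b s : drop_digits (S i) (enc (b :: s)) = drop_digits i (enc s).
Proof.
  destruct (enc_cons b s) as (_ & _ & H).
  induction i as [|i IH]; [exact H|].
  simpl in *; fold (drop_digits i (enc s)) in *.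
  change (pred (drop_digits (S i) (enc (b :: s))) / 2 = pred (drop_digits i (enc s)) / 2).
  f_equal; f_equal; exact IH.
Qed.

Lemma sum_shift n f : sum (S n) f = f 0 + sum n (fun i => f (S i)).
Proof. induction n as [|n IH]; [simpl; lia|]; cbn [sum] in *; lia. Qed.

(** A doubled symbol with digit d turns a code z into [4 z + 3 d], and the separator turns y into
    [4 y + 5]. The exponent counts the digits of [x]; the bound [x] exceeds or equals that number,
    and the surplus terms vanish. *)
Lemma npair_formula x y :
  npair x y = sum x (fun i => 3 * digit (drop_digits i x) * 4 ^ i) +
    4 ^ cnt x (fun i => 0 <? drop_digits i x) * (4 * y + 5).
Proof.
  assert (H : forall s n, length s <= n -> enc (pair_str s (dec y)) =
    sum n (fun i => 3 * digit (drop_digits i (enc s)) * 4 ^ i) +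
    4 ^ cnt n (fun i => 0 <? drop_digits i (enc s)) * (4 * y + 5)).
  { induction s as [|b s IH]; intros n Hn.
    - rewrite sum_ext with (g := fun _ => 0) by (intros; simpl enc; rewrite drop_digits_nil; reflexivity).
      rewrite cnt_ext with (Q := fun _ => false) by (intros; simpl enc; rewrite drop_digits_nil; reflexivity).
      unfold cnt; rewrite !sum_const; cbn [Nat.b2n].
      unfold pair_str; cbn [flat_map app enc]; rewrite enc_dec, !Nat.mul_0_r; simpl; lia.
    - destruct n as [|n]; [simpl in Hn; lia|]; simpl in Hn.
      unfold cnt; rewrite !sum_shift.
      rewrite (sum_ext n _ (fun i => 4 * (3 * digit (drop_digits i (enc s)) * 4 ^ i)))
        by (intros; rewrite drop_digits_cons; cbn [Nat.pow]; lia).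
      rewrite (sum_ext n (fun i => Nat.b2n (0 <? drop_digits (S i) (enc (b :: s))))
        (fun i => Nat.b2n (0 <? drop_digits i (enc s))))
        by (intros; rewrite drop_digits_cons; auto).
      fold (cnt n (fun i => 0 <? drop_digits i (enc s))); rewrite sum_mul.
      specialize (IH n ltac:(lia)).
      change (pair_str (b :: s) (dec y)) with (b :: b :: pair_str s (dec y)).
      change (drop_digits 0 (enc (b :: s))) with (enc (b :: s)).
      destruct (enc_cons b s) as (E & Hd & _).
      assert (Hd' : digit (enc (b :: s)) = if b then 2 else 1) by (cbn [enc] in *; destruct b; lia).
      replace (0 <? enc (b :: s)) with true by (symmetry; apply Nat.ltb_lt; lia).
      rewrite Hd'; cbn [Nat.b2n Nat.add Nat.pow]; cbn [enc]; rewrite IH; destruct b; lia. }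
  assert (Hx : length (dec x) <= x).
  { pose proof (enc_bounds (dec x)) as Hb; rewrite enc_dec in Hb.
    pose proof (Nat.pow_gt_lin_r 2 (length (dec x)) ltac:(lia)); lia. }
  unfold npair; rewrite (H (dec x) x Hx), enc_dec; auto.
Qed.

Lemma npair_computable : Computable2 npair.
Proof.
  assert (H1 : Computable1 digit) by (unfold Computable1, digit; computable).
  assert (H2 : Computable2 drop_digits).
  { unfold Computable2, drop_digits.
    apply (Comp_nat_rect 2 (fun v => nth 0 v 0) (fun v => nth 1 v 0) (fun _ r _ => pred r / 2));
      computable. }
  eapply Comp_ext; [|intros v _; symmetry; apply npair_formula]; computable.
Qed.

Lemma npair_gt x y : x < npair x y /\ y < npair x y.
Proof.
  rewrite <- (enc_dec x), <- (enc_dec y), npair_enc.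
  generalize (dec x) as s, (dec y) as t; intros s t.
  induction s as [|b s IH].
  - unfold pair_str; cbn [flat_map app enc]; lia.
  - change (pair_str (b :: s) t) with (b :: b :: pair_str s t); cbn [enc] in *; destruct b; lia.
Qed.

(** A bounded search written as a sum with one surviving term; components are smaller than the code
    of their pair. *)
Definition nfst (z : nat) : nat := sum z (fun x => x * Nat.b2n (bex z (fun y => npair x y =? z))).
Definition nsnd (z : nat) : nat := sum z (fun y => y * Nat.b2n (bex z (fun x => npair x y =? z))).

Lemma nfst_computable : Computable1 nfst.
Proof. pose proof npair_computable; unfold Computable1, nfst; computable. Qed.

Lemma nsnd_computable : Computable1 nsnd.
Proof. pose proof npair_computable; unfold Computable1, nsnd; computable. Qed.

Lemma sum_single n f j : j < n -> (forall i, i < n -> i <> j -> f i = 0) -> sum n f = f j.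
Proof.
  induction n as [|n IH]; intros Hj H; [lia|]; cbn [sum].
  destruct (Nat.eq_dec j n) as [->|Hn].
  - rewrite (sum_ext n f (fun _ => 0)); [rewrite sum_const; lia|].
    intros i Hi; apply H; lia.
  - rewrite IH, (H n); auto; lia.
Qed.

Lemma nfst_npair x y : nfst (npair x y) = x.
Proof.
  destruct (npair_gt x y); unfold nfst; rewrite (sum_single _ _ x); auto.
  - replace (bex _ _) with true; [simpl; lia|].
    symmetry; apply bex_spec; exists y; split; auto; apply Nat.eqb_refl.
  - intros x' _ Hx'; destruct (bex _ _) eqn:E; [|simpl; lia].
    apply bex_spec in E; destruct E as (y' & _ & E); apply Nat.eqb_eq, npair_inj in E; tauto.
Qed.

Lemma nsnd_npair x y : nsnd (npair x y) = y.
Proof.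
  destruct (npair_gt x y); unfold nsnd; rewrite (sum_single _ _ y); auto.
  - replace (bex _ _) with true; [simpl; lia|].
    symmetry; apply bex_spec; exists x; split; auto; apply Nat.eqb_refl.
  - intros y' _ Hy'; destruct (bex _ _) eqn:E; [|simpl; lia].
    apply bex_spec in E; destruct E as (x' & _ & E); apply Nat.eqb_eq, npair_inj in E; tauto.
Qed.

(** * Kolmogorov complexity *)

Lemma least_witness (P : nat -> Prop) : (exists n, P n) -> exists n, P n /\ forall m, m < n -> ~ P m.
Proof.
  intros [n Hn]; induction n as [n IH] using lt_wf_ind.
  destruct (classic (exists m, m < n /\ P m)) as [(m & Hm & HP)|H]; eauto.
  exists n; split; auto; intros m Hm HP; eauto.
Qed.

Lemma computable_dec_of_program e :
  computable_dec (fun p y x => Ev e [enc p; enc y] (enc x)).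
Proof. exists e; intros; reflexivity. Qed.

(** [epsilon] returns the minimum once some program exists; optimality applied to the decompressor
    that outputs its own program supplies one. *)
Lemma KS_spec U x y : optimal U -> KS_is U x y (KS U x y).
Proof.
  intros [_ HU]; apply (epsilon_spec (inhabits 0) (fun k => KS_is U x y k)).
  destruct (HU _ (computable_dec_of_program (PProj 0))) as [c Hc].
  destruct (Hc x y x) as (q & _ & Hq); [exists 1; reflexivity|].
  destruct (least_witness (fun k => exists p, length p = k /\ U p y x)) as (k & Hk & Hmin); eauto.
  exists k; split; auto; intros p Hp; destruct (le_lt_dec k (length p)); auto.
  destruct (Hmin (length p)); eauto.
Qed.

Lemma KS_le U p y x : optimal U -> U p y x -> KS U x y <= length p.
Proof. intros HU; apply (KS_spec U x y HU). Qed.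

Lemma KS_program U y x : optimal U -> exists p, length p = KS U x y /\ U p y x.
Proof. intros HU; apply (KS_spec U x y HU). Qed.

Lemma KS_le_length U : optimal U -> exists c, forall x y, KS U x y <= length x + c.
Proof.
  intros HU; destruct (proj2 HU _ (computable_dec_of_program (PProj 0))) as [c Hc].
  exists c; intros x y; destruct (Hc x y x) as (q & Hl & Hq); [exists 1; reflexivity|].
  etransitivity; [apply (KS_le _ _ _ _ HU Hq)|auto].
Qed.

(* [z] codes a pair (element, stage) that is the first to witness its element. *)
Definition first_witness (T : nat -> nat -> nat -> nat -> bool) (pi y z : nat) : bool :=
  T (nsnd z) pi y (nfst z) &&
  negb (bex z (fun z' => T (nsnd z') pi y (nfst z') && (nfst z' =? nfst z))).

Lemma first_witness_spec T pi y z : first_witness T pi y z = true <->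
  T (nsnd z) pi y (nfst z) = true /\
  forall z', z' < z -> T (nsnd z') pi y (nfst z') = true -> nfst z' <> nfst z.
Proof.
  unfold first_witness; rewrite andb_true_iff, negb_true_iff, <- not_true_iff_false, bex_spec.
  split; intros [HT H]; split; auto.
  - intros z' Hz' HT' E; apply H; exists z'; split; auto.
    rewrite HT', E; apply Nat.eqb_refl.
  - intros (z' & Hz' & E); apply andb_true_iff in E; destruct E as [HT' E].
    apply Nat.eqb_eq in E; apply (H z'); auto.
Qed.

Lemma cnt_lt n m P : n < m -> P n = true -> cnt n P < cnt m P.
Proof.
  intros Hnm HP; induction Hnm as [|m Hnm IH]; unfold cnt in *; cbn [sum].
  - rewrite HP; simpl; lia.
  - lia.
Qed.

(* A member of an enumerable set is described by its ordinal number in the enumeration. *)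
Lemma KS_le_of_enumeration U T : optimal U -> Decidable4 T ->
  exists C, forall pi l y x w,
    card_le (fun x => exists w, T w pi (enc y) x = true) (2 ^ l) ->
    T w pi (enc y) (enc x) = true ->
    KS U x y <= 2 * length (dec pi) + l + C.
Proof.
  intros HU HT.
  (* Negated because minimisation looks for a zero: the first witness preceded by exactly [nsnd p]
     others. *)
  set (Q := fun z p y => negb (first_witness T (nfst p) y z &&
    (cnt z (first_witness T (nfst p) y) =? nsnd p))).
  assert (HQ : CompB 3 (fun v => Q (nth 0 v 0) (nth 1 v 0) (nth 2 v 0))).
  { pose proof nfst_computable; pose proof nsnd_computable.
    unfold Q, first_witness; computable. }
  destruct HQ as [eq Heq].
  destruct nfst_computable as [ef Hef].
  destruct (proj2 HU _ (computable_dec_of_program (PComp ef [PMu eq]))) as [c Hc].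
  (* The program is the pair of [pi] and the ordinal number: [pair_str] doubles the former and adds
     a separator of length 2. *)
  exists (c + 2); intros pi l y x w Hcard Hw.
  destruct (least_witness (fun z => T (nsnd z) pi (enc y) (nfst z) = true /\ nfst z = enc x))
    as (z & [Hz Hzx] & Hmin).
  { exists (npair (enc x) w); rewrite nfst_npair, nsnd_npair; auto. }
  set (new := first_witness T pi (enc y)).
  assert (Hnew : new z = true).
  { apply first_witness_spec; split; auto; intros z' Hlt HT' E.
    apply (Hmin z' Hlt); split; auto; congruence. }
  set (i := cnt z new).
  assert (Hi : i < 2 ^ l).
  (* First witnesses have distinct elements; counting [z] itself makes the inequality for [i]
     strict. *)
  { assert (cnt (S z) new <= 2 ^ l) as H.
    { rewrite cnt_filter, <- (length_map nfst); apply Hcard.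
      - apply NoDup_map_NoDup_ForallPairs; [|apply NoDup_filter, seq_NoDup].
        intros z1 z2 H1 H2 E; apply filter_In in H1, H2.
        destruct H1 as [_ H1], H2 as [_ H2]; apply first_witness_spec in H1, H2.
        destruct (lt_eq_lt_dec z1 z2) as [[Hlt|]|Hlt]; auto; exfalso.
        + apply (proj2 H2 z1); tauto.
        + apply (proj2 H1 z2); [tauto|tauto|auto].
      - intros x' Hx'; apply in_map_iff in Hx'; destruct Hx' as (z' & <- & Hz').
        apply filter_In in Hz'; destruct Hz' as [_ Hz'].
        apply first_witness_spec in Hz'; exists (nsnd z'); tauto. }
    unfold cnt in H; cbn [sum] in H; rewrite Hnew in H; cbn [Nat.b2n] in H.
    unfold i, cnt; lia. }
  set (p := pair_str (dec pi) (dec i)).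
  assert (Hp : enc p = npair pi i) by reflexivity.
  destruct (Hc p y x) as (q & Hq & HUq).
  { rewrite Hp; apply (Ev_comp _ _ _ [z]).
    - constructor; [|constructor].
      apply (Ev_mu _ _ (fun z => Nat.b2n (Q z (npair pi i) (enc y)))).
      + intros z'; apply (Heq [z'; npair pi i; enc y]); auto.
      + unfold Q; rewrite nfst_npair, nsnd_npair; fold new i; rewrite Hnew, Nat.eqb_refl; auto.
      + intros z' Hlt; unfold Q; rewrite nfst_npair, nsnd_npair; fold new.
        destruct (new z') eqn:E; [|discriminate].
        replace (cnt z' new =? i) with false; [discriminate|].
        symmetry; apply Nat.eqb_neq; pose proof (cnt_lt z' z new Hlt E); unfold i; lia.
    - rewrite <- Hzx; apply (Hef [z]); auto. }
  apply (KS_le _ _ _ _ HU) in HUq.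
  unfold p in Hq; rewrite length_pair_str in Hq.
  pose proof (length_dec_le i l Hi); lia.
Qed.

Lemma computable_dec_stages U : computable_dec U ->
  exists Us, Decidable4 Us /\
    (forall w w' p y x, w <= w' -> Us w p y x = true -> Us w' p y x = true) /\
    (forall p y x, U p y x <-> exists w, Us w (enc p) (enc y) (enc x) = true) /\
    (forall w p y x x', Us w p y x = true -> Us w p y x' = true -> x = x').
Proof.
  intros [e He].
  exists (fun w p y x => opt_code (eval w e [p; y]) =? S x).
  assert (HS : forall w p y x, (opt_code (eval w e [p; y]) =? S x) = true <->
    eval w e [p; y] = Some x).
  { intros w p y x; rewrite Nat.eqb_eq; destruct (eval w e [p; y]); simpl;
      split; intros H; congruence. }
  split; [|split; [|split]].
  - assert (H : Computable3 (fun w p y => opt_code (eval w e [p; y]))).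
    { eapply Comp_ext; [apply (Comp_eval e 2)|].
      intros [|w [|p [|y [|]]]] Hv; try discriminate; reflexivity. }
    apply (CompB_eqb 4 (fun v => opt_code (eval (nth 0 v 0) e [nth 1 v 0; nth 2 v 0])));
      [|computable].
    apply (Computable3_app _ 4 _ _ _ H); computable.
  - intros w w' p y x Hw; rewrite !HS; apply eval_mono; auto.
  - intros p y x; rewrite He; split; intros [w Hw]; exists w; apply HS; auto.
  - intros w p y x x'; rewrite !HS; congruence.
Qed.

(** Exhaustive search for the least [y]; it makes the disperser a function of the parameters
    alone. *)
Lemma computable_choice P : Decidable2 P -> (forall x, exists y, P x y = true) ->
  exists G, Computable1 G /\ forall x, P x (G x) = true.
Proof.
  intros HP Hex.
  set (Q := fun x z => P x z = true /\ forall z', z' < z -> ~ P x z' = true).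
  destruct (choice Q) as [G HG].
  { intros x; apply (least_witness (fun y => P x y = true)); auto. }
  exists G; split; [|intros x; apply HG].
  assert (CompB 2 (fun v => negb (P (nth 1 v 0) (nth 0 v 0)))) as [e He] by computable.
  exists (PMu e); intros [|x [|]] Hv; try discriminate; simpl nth.
  destruct (HG x) as [H1 H2].
  apply (Ev_mu _ _ (fun y => Nat.b2n (negb (P x y)))).
  - intros y; apply (He [y; x]); auto.
  - rewrite H1; auto.
  - intros y Hy; apply H2, not_true_is_false in Hy; rewrite Hy; discriminate.
Qed.

(** Finite tables become numbers; the bound [M ^ n] turns quantification over all small sets into a
    bounded one. *)
Lemma digits_exist M n (e : nat -> nat) : (forall i, e i < M) ->
  exists u, u < M ^ n /\ forall i, i < n -> (u / M ^ i) mod M = e i.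
Proof.
  intros He; assert (HM : 0 < M) by (specialize (He 0); lia).
  revert e He; induction n as [|n IH]; intros e He.
  - exists 0; split; [simpl; lia|intros; lia].
  - destruct (IH (fun i => e (S i))) as (u & Hu & Hd); [auto|].
    exists (e 0 + u * M); split; [specialize (He 0); cbn [Nat.pow]; nia|].
    intros [|i] Hi.
    + rewrite Nat.div_1_r, Nat.Div0.mod_add; apply Nat.mod_small; auto.
    + cbn [Nat.pow]; rewrite <- Nat.Div0.div_div, Nat.div_add, (Nat.div_small (e 0)) by (auto; lia).
      apply Hd; lia.
Qed.

(** * The hash function *)

Definition params (N k j r m : nat) : nat := npair N (npair k (npair j (npair r m))).
Definition par_N (pi : nat) : nat := nfst pi.
Definition par_k (pi : nat) : nat := nfst (nsnd pi).
Definition par_j (pi : nat) : nat := nfst (nsnd (nsnd pi)).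
Definition par_r (pi : nat) : nat := nfst (nsnd (nsnd (nsnd pi))).
Definition par_m (pi : nat) : nat := nsnd (nsnd (nsnd (nsnd pi))).

Lemma params_spec N k j r m :
  par_N (params N k j r m) = N /\ par_k (params N k j r m) = k /\
  par_j (params N k j r m) = j /\ par_r (params N k j r m) = r /\ par_m (params N k j r m) = m.
Proof.
  unfold par_N, par_k, par_j, par_r, par_m, params; repeat rewrite ?nfst_npair, ?nsnd_npair; auto.
Qed.

Definition n_words (pi : nat) : nat := 2 ^ S (par_N pi).
(** Dictated by [disperser_exists]: the 3 makes [range] equal to 8 times [small], and [2 ^ half] is
    exactly [4 * range * n_words]. *)
Definition range (pi : nat) : nat := 2 ^ (par_j pi + 3).
Definition small (pi : nat) : nat := 2 ^ par_j pi.
Definition half (pi : nat) : nat := par_N pi + par_j pi + 6.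
Definition degree (pi : nat) : nat := 2 * half pi.

Lemma params_computable :
  Computable1 par_k /\ Computable1 par_j /\ Computable1 par_r /\ Computable1 par_m /\
  Computable1 n_words /\ Computable1 range /\ Computable1 small /\ Computable1 half /\
  Computable1 degree.
Proof.
  pose proof nfst_computable; pose proof nsnd_computable.
  repeat split; unfold Computable1, degree, half, small, range, n_words, par_N, par_k, par_j, par_r, par_m;
    computable.
Qed.

Lemma range_pos pi : 2 <= range pi.
Proof. unfold range; rewrite Nat.add_comm; cbn [Nat.pow Nat.add]; pose proof (Nat.pow_nonzero 2 (par_j pi)); lia. Qed.

(* A table [E] of entries [E x t < range], [t < degree], is coded by the number [g] with
   base-[range] digits [E x t]; likewise a set of [small] values by the number [u]. *)
Definition entry (pi g x t : nat) : nat := (g / range pi ^ (x * degree pi + t)) mod range pi.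

Definition coded_set (pi u y : nat) : bool :=
  bex (small pi) (fun i => y =? (u / range pi ^ i) mod range pi).

Definition is_disperser (pi g : nat) : bool :=
  negb (bex (range pi ^ small pi) (fun u =>
    small pi <? cnt (n_words pi) (fun x =>
      half pi <=? cnt (degree pi) (fun t => coded_set pi u (entry pi g x t))))).

Lemma is_disperser_computable : Decidable2 is_disperser.
Proof.
  destruct params_computable as (Hk & Hj & Hr & Hm & Hw & HM & Hs & Hh & HD).
  unfold Decidable2, is_disperser, coded_set, entry; computable.
Qed.

Lemma is_disperser_exists pi : exists g, is_disperser pi g = true.
Proof.
  destruct (disperser_exists (n_words pi) (small pi) (range pi) (half pi)) as (E & HE & Hdisp).
  - apply range_pos.
  - unfold small, range; rewrite Nat.pow_add_r; change (2 ^ 3) with 8; lia.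
  - unfold n_words, range, half; change (4 * 2 ^ (par_j pi + 3)) with (2 ^ 2 * 2 ^ (par_j pi + 3)).
    rewrite <- !Nat.pow_add_r; apply Nat.pow_le_mono_r; lia.
  - destruct (digits_exist (range pi) (n_words pi * degree pi)
      (fun n => E (n / degree pi) (n mod degree pi))) as (g & _ & Hg); [auto|].
    exists g; apply negb_true_iff, not_true_is_false; rewrite bex_spec.
    intros (u & _ & Hu); apply Nat.ltb_lt in Hu; revert Hu; apply Nat.le_ngt.
    set (B := map (fun i => (u / range pi ^ i) mod range pi) (seq 0 (small pi))).
    assert (HB : forall y, coded_set pi u y = memb B y).
    { intros y; apply eq_iff_eq_true; unfold coded_set, B.
      rewrite bex_spec, memb_spec, in_map_iff; split.
      - intros (i & Hi & Hy); apply Nat.eqb_eq in Hy; exists i; rewrite in_seq; split; auto; lia.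
      - intros (i & Hy & Hi); apply in_seq in Hi; exists i; split; [lia|apply Nat.eqb_eq; auto]. }
    erewrite cnt_ext; [apply (Hdisp B)|].
    + unfold B; rewrite length_map, length_seq; auto.
    + intros y Hy; apply in_map_iff in Hy; destruct Hy as (i & <- & _).
      apply Nat.mod_upper_bound; pose proof (range_pos pi); lia.
    + intros x Hx; apply (f_equal (Nat.leb (half pi))), cnt_ext; intros t Ht.
      rewrite HB; f_equal; unfold entry.
      assert (HD : degree pi <> 0) by (unfold degree; lia).
      change (t < degree pi) in Ht.
      assert (x * degree pi + t < n_words pi * degree pi) by nia.
      rewrite Hg by auto.
      rewrite Nat.div_add_l, Nat.div_small, Nat.add_0_r by auto.
      rewrite Nat.add_comm, Nat.Div0.mod_add, Nat.mod_small; auto.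
Qed.

Definition hash (G : nat -> nat) (pi a s b t : nat) : nat :=
  (entry pi (G pi) a s + entry pi (G pi) b t) mod range pi.

Lemma hash_lt G pi a s b t : hash G pi a s b t < range pi.
Proof. apply Nat.mod_upper_bound; pose proof (range_pos pi); lia. Qed.

Lemma hash_computable G : Computable1 G -> Computable5 (hash G).
Proof.
  destruct params_computable as (Hk & Hj & Hr & Hm & Hw & HM & Hs & Hh & HD).
  intros HG; unfold Computable5, hash, entry; computable.
Qed.

Lemma disperser_few pi g (Q : nat -> bool) :
  is_disperser pi g = true ->
  card_le (fun y => y < range pi /\ Q y = true) (small pi) ->
  cnt (n_words pi) (fun x => half pi <=? cnt (degree pi) (fun t => Q (entry pi g x t))) <= small pi.
Proof.
  intros Hg HQ; pose proof (range_pos pi) as HM.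
  set (l := filter Q (seq 0 (range pi))).
  assert (Hin : forall y, In y l <-> y < range pi /\ Q y = true).
  { intros y; unfold l; rewrite filter_In, in_seq; split; intros [? ?]; split; auto; lia. }
  assert (Hl : length l <= small pi).
  { apply HQ; [apply NoDup_filter, seq_NoDup|intros; apply Hin; auto]. }
  (* A shorter list is padded with 0; a larger set can only raise the counts. *)
  destruct (digits_exist (range pi) (small pi) (fun i => nth i l 0)) as (u & Hu & Hd).
  { intros i; destruct (nth_in_or_default i l 0) as [H| ->]; [apply Hin; auto|lia]. }
  apply negb_true_iff in Hg; apply Nat.le_ngt; intros Hlt.
  apply not_true_iff_false in Hg; apply Hg, bex_spec; exists u; split; auto.
  apply Nat.ltb_lt; eapply Nat.lt_le_trans; [exact Hlt|].
  apply cnt_le; intros x _ H; apply Nat.leb_le in H; apply Nat.leb_le.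
  etransitivity; [exact H|]; apply cnt_le; intros t _ HQt.
  destruct (In_nth l (entry pi g x t) 0) as (i & Hi & Ei).
  { apply Hin; split; auto; apply Nat.mod_upper_bound; lia. }
  apply bex_spec; exists i; split; [lia|]; apply Nat.eqb_eq; rewrite Hd; [auto|lia].
Qed.

Lemma card_le_translate M c n (Q : nat -> bool) :
  card_le (fun y => y < M /\ Q y = true) n ->
  card_le (fun y => y < M /\ Q ((c + y) mod M) = true) n.
Proof.
  intros H; apply (card_le_inj (fun y => (c + y) mod M) _ _ _ H).
  - intros y [Hy HQ]; split; auto; apply Nat.mod_upper_bound; lia.
  - intros x y [Hx _] [Hy _] E.
    pose proof (Nat.div_mod_eq (c + x) M); pose proof (Nat.div_mod_eq (c + y) M).
    set (q := (c + x) / M) in *; set (q' := (c + y) / M) in *.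
    destruct (lt_eq_lt_dec q q') as [[Hq|Hq]|Hq]; [exfalso| |exfalso]; nia.
Qed.

Lemma hash_few_l G pi a s (Q : nat -> bool) :
  is_disperser pi (G pi) = true ->
  card_le (fun y => y < range pi /\ Q y = true) (small pi) ->
  card_le (fun b => b < n_words pi /\
    (half pi <=? cnt (degree pi) (fun t => Q (hash G pi a s b t))) = true) (small pi).
Proof.
  intros HG HQ; eapply card_le_impl; [apply card_le_cnt|intros x Hx; exact Hx|].
  apply (disperser_few pi (G pi) (fun y => Q ((entry pi (G pi) a s + y) mod range pi)) HG).
  apply card_le_translate, HQ.
Qed.

Lemma hash_few_r G pi b t (Q : nat -> bool) :
  is_disperser pi (G pi) = true ->
  card_le (fun y => y < range pi /\ Q y = true) (small pi) ->
  card_le (fun a => a < n_words pi /\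
    (half pi <=? cnt (degree pi) (fun s => Q (hash G pi a s b t))) = true) (small pi).
Proof.
  intros HG HQ; eapply card_le_impl; [apply (hash_few_l G pi b t Q HG HQ)| |auto].
  intros a [Ha H]; split; auto; rewrite <- H; f_equal; apply cnt_ext; intros s _.
  unfold hash; rewrite Nat.add_comm; auto.
Qed.

(** * Enumerable sets of exceptional strings *)

Section Enumerations.
Context (Us : nat -> nat -> nat -> nat -> bool) (G : nat -> nat).
Context (Us_computable : Decidable4 Us) (G_computable : Computable1 G).
Context (Us_mono : forall w w' p y x, w <= w' -> Us w p y x = true -> Us w' p y x = true).
Context (Us_fun : forall w p y x x', Us w p y x = true -> Us w p y x' = true -> x = x').
Context (G_disperser : forall pi, is_disperser pi (G pi) = true).

(* At stage [w], the complexity of [x] given [y] is known to be less than [s]. *)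
Definition KS_lt (w s y x : nat) : bool := bex (2 ^ s - 1) (fun p => Us w p y x).

(** The strings [b] that remain possible for someone who knows [a], [f] and k; [S (par_k pi)]
    because [KS_lt] is strict. *)
Definition load (w pi a f b : nat) : bool :=
  KS_lt w (S (par_k pi)) a b &&
  bex (degree pi) (fun s => bex (degree pi) (fun t => hash G pi a s b t =? f)).

(** At most [2 ^ (k + 1)] strings with [degree ^ 2] hashes each, divided by [2 ^ j]: no more than
    [2 ^ j] values can exceed this load. *)
Definition max_load (pi : nat) : nat := 2 ^ (S (par_k pi) - par_j pi) * (degree pi * degree pi).

Definition overloaded (w pi a f : nat) : bool :=
  max_load pi <? cnt (n_words pi) (load w pi a f).

(** [loaded], [crowded], [revealed] and [some_unlucky] have the argument order of
    [KS_le_of_enumeration]: stage, parameters, condition, element. *)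
Definition loaded (w pi af b : nat) : bool :=
  (b <? n_words pi) && load w pi (nfst af) (nsnd af) b.

Definition crowded (w pi a b : nat) : bool :=
  (b <? n_words pi) && bex (degree pi) (fun s =>
    half pi <=? cnt (degree pi) (fun t => overloaded w pi a (hash G pi a s b t))).

Definition reveals (w pi c b f : nat) : bool := KS_lt w (par_r pi) (npair c f) b.

Definition revealed (w pi c b : nat) : bool := small pi <? cnt (range pi) (reveals w pi c b).

Definition unlucky (w pi c b a : nat) : bool :=
  bex (degree pi) (fun t =>
    half pi <=? cnt (degree pi) (fun s => reveals w pi c b (hash G pi a s b t))).

Definition some_unlucky (w pi c a : nat) : bool :=
  (a <? n_words pi) && bex (n_words pi) (fun b =>
    KS_lt w (S (par_m pi)) c b && ((cnt (range pi) (reveals w pi c b) <=? small pi) &&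
    unlucky w pi c b a)).

Lemma enumerations_computable :
  Decidable4 loaded /\ Decidable4 crowded /\ Decidable4 revealed /\ Decidable4 some_unlucky.
Proof using Us_computable G_computable.
  destruct params_computable as (Hk & Hj & Hr & Hm & Hw & HM & Hs & Hh & HD).
  pose proof nfst_computable; pose proof nsnd_computable; pose proof npair_computable.
  pose proof (hash_computable G G_computable) as HG.
  assert (HKS : Decidable4 KS_lt) by (unfold Decidable4, KS_lt; computable).
  assert (Hload : Decidable5 load) by (unfold Decidable5, load; computable).
  assert (Hover : Decidable4 overloaded).
  { unfold Decidable4, overloaded, max_load; apply CompB_ltb; computable. }
  assert (Hrev : Decidable5 reveals) by (unfold Decidable5, reveals; computable).
  assert (Hunl : Decidable5 unlucky) by (unfold Decidable5, unlucky; computable).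
  repeat split; unfold Decidable4, loaded, crowded, revealed, some_unlucky; computable.
Qed.

(** * Growth of the stages and sizes of the exceptional sets *)

Lemma KS_lt_mono w w' s y x : w <= w' -> KS_lt w s y x = true -> KS_lt w' s y x = true.
Proof using Us_mono.
  unfold KS_lt; rewrite !bex_spec; intros Hw (p & Hp & H); exists p; split; auto; eapply Us_mono; eauto.
Qed.

Lemma load_mono w w' pi a f b : w <= w' -> load w pi a f b = true -> load w' pi a f b = true.
Proof using Us_mono.
  unfold load; rewrite !andb_true_iff; intros Hw [H1 H2]; split; auto; eapply KS_lt_mono; eauto.
Qed.

Lemma overloaded_mono w w' pi a f :
  w <= w' -> overloaded w pi a f = true -> overloaded w' pi a f = true.
Proof using Us_mono.
  unfold overloaded; rewrite !Nat.ltb_lt; intros Hw H; eapply Nat.lt_le_trans; [exact H|].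
  apply cnt_le; intros; eapply load_mono; eauto.
Qed.

Lemma bex_half_mono D h (P Q : nat -> nat -> bool) :
  (forall s t, P s t = true -> Q s t = true) ->
  bex D (fun s => h <=? cnt D (P s)) = true -> bex D (fun s => h <=? cnt D (Q s)) = true.
Proof.
  intros H; rewrite !bex_spec; intros (s & Hs & Hh); exists s; split; auto.
  apply Nat.leb_le in Hh; apply Nat.leb_le; etransitivity; [exact Hh|]; apply cnt_le; auto.
Qed.

Lemma crowded_mono w w' pi a b : w <= w' -> crowded w pi a b = true -> crowded w' pi a b = true.
Proof using Us_mono.
  unfold crowded; rewrite !andb_true_iff; intros Hw [H1 H2]; split; auto; revert H2.
  apply bex_half_mono; intros s t; apply overloaded_mono; auto.
Qed.

Lemma reveals_mono w w' pi c b f : w <= w' -> reveals w pi c b f = true -> reveals w' pi c b f = true.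
Proof using Us_mono. apply KS_lt_mono. Qed.

Lemma card_KS_lt w s y : card_le (fun x => KS_lt w s y x = true) (2 ^ s).
Proof using Us_fun.
  apply card_le_impl with (Q := fun x => exists p, p < 2 ^ s - 1 /\ Us w p y x = true)
    (n := (2 ^ s - 1) * 1); [| |lia].
  - apply card_le_ex_lt; intros p _; apply card_le_functional; intros; eapply Us_fun; eauto.
  - intros x; apply bex_spec.
Qed.

Lemma card_loaded pi a f : (forall w, overloaded w pi a f = false) ->
  card_le (fun b => exists w, loaded w pi (npair a f) b = true) (max_load pi).
Proof using Us_mono.
  intros H; apply card_le_mono.
  - unfold loaded; intros w w' b Hw; rewrite !andb_true_iff; intros [H1 H2]; split; auto.
    eapply load_mono; eauto.
  - intros w; specialize (H w); apply Nat.ltb_ge in H.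
    eapply card_le_impl; [apply card_le_cnt with (P := load w pi a f)| |exact H].
    intros b Hb; unfold loaded in Hb; rewrite nfst_npair, nsnd_npair in Hb.
    apply andb_true_iff in Hb; rewrite Nat.ltb_lt in Hb; auto.
Qed.

(* Each of the at most [2 ^ (k + 1)] strings [b] loads at most [degree ^ 2] values. *)
Lemma overloaded_count w pi a l : par_j pi <= S (par_k pi) ->
  NoDup l -> (forall f, In f l -> overloaded w pi a f = true) ->
  length l * S (max_load pi) <= small pi * max_load pi.
Proof using Us_fun.
  intros Hjk Hl Hin.
  set (D := degree pi).
  transitivity (sum (n_words pi) (fun b => D * D * Nat.b2n (KS_lt w (S (par_k pi)) a b))).
  - apply (card_le_double_count (fun f b => load w pi a f b)); auto.
    + intros b _; unfold load.
      destruct (KS_lt w (S (par_k pi)) a b); cbn [andb Nat.b2n].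
      * rewrite Nat.mul_1_r.
        apply card_le_impl with (n := D * (D * 1)) (Q := fun f => exists s, s < D /\
          exists t, t < D /\ hash G pi a s b t = f); [| |lia].
        { apply card_le_ex_lt; intros s _; apply card_le_ex_lt; intros t _.
          apply card_le_functional; intros; congruence. }
        intros f; rewrite bex_spec; intros (s & Hs & H); exists s; split; auto.
        apply bex_spec in H; destruct H as (t & Ht & H); exists t; split; auto.
        apply Nat.eqb_eq; auto.
      * intros [|f l'] _ H'; simpl; [lia|]; discriminate (H' f (or_introl eq_refl)).
    + intros f Hf; apply Nat.ltb_lt, Hin; auto.
  - rewrite sum_mul; change (sum _ _) with (cnt (n_words pi) (KS_lt w (S (par_k pi)) a)).
    assert (cnt (n_words pi) (KS_lt w (S (par_k pi)) a) <= 2 ^ S (par_k pi)) as H.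
    { apply cnt_le_card; eapply card_le_impl; [apply (card_KS_lt w (S (par_k pi)) a)| |auto].
      intros x [_ Hx]; exact Hx. }
    unfold max_load, small; fold D.
    rewrite Nat.mul_assoc, <- Nat.pow_add_r.
    replace (par_j pi + (S (par_k pi) - par_j pi)) with (S (par_k pi)) by lia.
    rewrite Nat.mul_comm; apply Nat.mul_le_mono_r; auto.
Qed.

Lemma card_overloaded w pi a : par_j pi <= S (par_k pi) ->
  card_le (fun f => overloaded w pi a f = true) (small pi).
Proof using Us_fun.
  intros Hjk l Hl Hin; pose proof (overloaded_count w pi a l Hjk Hl Hin); nia.
Qed.

(** With [small = 1] the double count excludes even one overloaded value. This settles the case of k
    below the logarithmic margin, where a complexity bound on [b] would contradict nothing. *)
Lemma not_overloaded w pi a f : par_j pi = 0 -> overloaded w pi a f = false.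
Proof using Us_fun.
  intros Hj; apply not_true_is_false; intros H.
  pose proof (overloaded_count w pi a [f]) as Hc; unfold small in Hc; rewrite Hj in Hc.
  simpl length in Hc; simpl (2 ^ 0) in Hc.
  assert (1 * S (max_load pi) <= 1 * max_load pi); [|lia].
  apply Hc; [lia|repeat constructor; intros []|intros f' [<-|[]]; auto].
Qed.

Lemma card_crowded pi a : par_j pi <= S (par_k pi) ->
  card_le (fun b => exists w, crowded w pi a b = true) (degree pi * small pi).
Proof using Us_mono Us_fun G_disperser.
  intros Hjk; apply card_le_mono; [intros w w' b; apply crowded_mono|intros w].
  eapply card_le_impl; [apply card_le_ex_lt; intros s Hs;
    apply (hash_few_l G pi a s (overloaded w pi a)); [apply G_disperser|]| |auto].
  - eapply card_le_impl; [apply (card_overloaded w pi a Hjk)| |auto]; intros f Hf; apply Hf.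
  - intros b Hb; apply andb_true_iff in Hb; destruct Hb as [Hb H].
    apply Nat.ltb_lt in Hb; apply bex_spec in H; destruct H as (s & Hs & H); eauto.
Qed.

(** Each of the [8 * 2 ^ j] values reveals at most [2 ^ r] strings, while a revealed string uses
    more than [2 ^ j] values; the 8 is the 3 in the exponent. *)
Lemma card_revealed pi c :
  card_le (fun b => exists w, revealed w pi c b = true) (2 ^ (par_r pi + 3)).
Proof using Us_mono Us_fun.
  apply card_le_mono.
  - unfold revealed; intros w w' b Hw; rewrite !Nat.ltb_lt; intros H.
    eapply Nat.lt_le_trans; [exact H|]; apply cnt_le; intros; eapply reveals_mono; eauto.
  - intros w l Hl Hin.
    assert (length l * S (small pi) <= sum (range pi) (fun _ => 2 ^ par_r pi)) as H.
    { apply (card_le_double_count (reveals w pi c)); auto.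
      - intros f _; apply card_KS_lt.
      - intros b Hb; apply Nat.ltb_lt, Hin; auto. }
    rewrite sum_const in H; unfold range, small in H; rewrite !Nat.pow_add_r in *.
    pose proof (Nat.pow_nonzero 2 (par_j pi) ltac:(discriminate)) as Hj.
    apply Nat.mul_le_mono_pos_l with (p := 2 ^ par_j pi); [lia|].
    etransitivity; [|etransitivity; [exact H|]]; [|apply Nat.eq_le_incl; ring].
    rewrite Nat.mul_comm; apply Nat.mul_le_mono_l; lia.
Qed.

(** While the guard on [reveals] holds the stages grow; once it fails it fails forever and the
    stages are empty. So any two stages are comparable. *)
Lemma card_unlucky pi c b :
  card_le (fun a => exists w, a < n_words pi /\ cnt (range pi) (reveals w pi c b) <= small pi /\
    unlucky w pi c b a = true) (degree pi * small pi).
Proof using Us_mono G_disperser.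
  apply card_le_chain.
  - assert (H : forall w w', w <= w' ->
      (forall a, a < n_words pi /\ cnt (range pi) (reveals w pi c b) <= small pi /\
         unlucky w pi c b a = true ->
       a < n_words pi /\ cnt (range pi) (reveals w' pi c b) <= small pi /\
         unlucky w' pi c b a = true) \/
      (forall a, a < n_words pi /\ cnt (range pi) (reveals w' pi c b) <= small pi /\
         unlucky w' pi c b a = true ->
       a < n_words pi /\ cnt (range pi) (reveals w pi c b) <= small pi /\
         unlucky w pi c b a = true)).
    { intros w w' Hw; destruct (le_lt_dec (cnt (range pi) (reveals w' pi c b)) (small pi)).
      - left; intros a (Ha & _ & Hu); split; [|split]; auto; revert Hu.
        apply bex_half_mono; intros t s; apply reveals_mono; auto.
      - right; intros a (_ & Hc & _); lia. }
    intros w w'; destruct (Nat.le_ge_cases w w') as [Hw|Hw]; specialize (H _ _ Hw); tauto.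
  - intros w; destruct (le_lt_dec (cnt (range pi) (reveals w pi c b)) (small pi)) as [Hc|Hc].
    + eapply card_le_impl; [apply card_le_ex_lt; intros t Ht;
        apply (hash_few_r G pi b t (reveals w pi c b)); [apply G_disperser|]| |auto].
      * eapply card_le_impl; [apply card_le_cnt|intros y Hy; exact Hy|exact Hc].
      * intros a (Ha & _ & H); apply bex_spec in H; destruct H as (t & Ht & H); eauto.
    + intros [|a l] _ Hin; simpl; [lia|]; destruct (Hin a (or_introl eq_refl)); lia.
Qed.

(** Guards of different [b] may fail at different stages, so the whole set need not be a chain of
    stages. Hence the union over stages is taken for each program of a [b] separately. *)
Lemma card_some_unlucky pi c :
  card_le (fun a => exists w, some_unlucky w pi c a = true)
    (2 ^ S (par_m pi) * (degree pi * small pi)).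
Proof using Us_mono Us_fun G_disperser.
  apply card_le_impl with (n := (2 ^ S (par_m pi) - 1) * (degree pi * small pi))
    (Q := fun a => exists p, p < 2 ^ S (par_m pi) - 1 /\ exists b w', Us w' p c b = true /\
      exists w, a < n_words pi /\ cnt (range pi) (reveals w pi c b) <= small pi /\
        unlucky w pi c b a = true); [| |apply Nat.mul_le_mono_r; lia].
  - apply card_le_ex_lt; intros p _.
    destruct (classic (exists b w', Us w' p c b = true)) as [(b & w' & Hb)|Hn].
    + eapply card_le_impl; [apply (card_unlucky pi c b)| |auto].
      intros a (b' & w'' & Hb' & Ha).
      replace b with b'; auto; apply (Us_fun (w' + w'') p c); eapply Us_mono; [|eauto| |eauto]; lia.
    + intros [|a l] _ Hin; simpl; [lia|].
      destruct (Hin a (or_introl eq_refl)) as (b & w' & Hb & _); destruct Hn; eauto.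
  - intros a (w & H); apply andb_true_iff in H; destruct H as [Ha H]; apply Nat.ltb_lt in Ha.
    apply bex_spec in H; destruct H as (b & _ & H); rewrite !andb_true_iff in H.
    destruct H as (HK & Hc & Hu); apply Nat.leb_le in Hc.
    apply bex_spec in HK; destruct HK as (p & Hp & HK); eauto 10.
Qed.

(** Excluded middle for each of finitely many indices; the stage is not computed, it only serves to
    pick the pair of edges. *)
Lemma stable_stage (P : nat -> nat -> bool) n :
  (forall w w' i, w <= w' -> P w i = true -> P w' i = true) ->
  exists W, forall i, i < n -> forall w, W <= w -> forall w', P w i = false -> P w' i = false.
Proof.
  intros Hm; induction n as [|n [W HW]]; [exists 0; intros; lia|].
  destruct (classic (exists w, P w n = true)) as [[w0 H0]|Hn].
  - exists (W + w0); intros i Hi w Hw w' Hf.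
    destruct (Nat.eq_dec i n) as [->|].
    + rewrite (Hm w0 w n) in Hf; [discriminate|lia|auto].
    + apply (HW i ltac:(lia) w); auto; lia.
  - exists W; intros i Hi w Hw w' Hf.
    destruct (Nat.eq_dec i n) as [->|].
    + apply not_true_is_false; intros H; eauto.
    + apply (HW i ltac:(lia) w); auto; lia.
Qed.

Lemma common_good_pair h (P Q : nat -> nat -> bool) : 0 < h ->
  (forall s, s < 2 * h -> cnt (2 * h) (P s) < h) ->
  (forall t, t < 2 * h -> cnt (2 * h) (fun s => Q s t) < h) ->
  exists s t, s < 2 * h /\ t < 2 * h /\ P s t = false /\ Q s t = false.
Proof.
  intros Hh HP HQ; set (D := 2 * h) in *.
  destruct (classic (exists s t, s < D /\ t < D /\ P s t = false /\ Q s t = false)) as [|Hn]; auto.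
  exfalso.
  assert (D * (D * 1) <= sum D (fun s => cnt D (P s)) + sum D (fun s => cnt D (Q s))) as H.
  { rewrite <- sum_add, <- !sum_const; apply sum_le; intros s Hs.
    unfold cnt; rewrite <- sum_add; apply sum_le; intros t Ht.
    destruct (P s t) eqn:EP; [simpl; lia|]; destruct (Q s t) eqn:EQ; [simpl; lia|].
    destruct Hn; exists s, t; auto. }
  assert (sum D (fun s => cnt D (P s)) <= D * (h - 1)) as H1.
  { rewrite <- sum_const; apply sum_le; intros s Hs; specialize (HP s Hs); lia. }
  assert (sum D (fun s => cnt D (Q s)) <= D * (h - 1)) as H2.
  { unfold cnt; rewrite sum_swap, <- sum_const; apply sum_le; intros t Ht.
    specialize (HQ t Ht); unfold cnt in HQ; lia. }
  unfold D in *; nia.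
Qed.

(* The limit stage exists because only finitely many values [f < range] matter. *)
Lemma good_hash_value pi a b c :
  (forall w, crowded w pi a b = false) -> (forall w, revealed w pi c b = false) ->
  (forall w, some_unlucky w pi c a = false) ->
  a < n_words pi -> b < n_words pi -> (exists w, KS_lt w (S (par_m pi)) c b = true) ->
  exists s t, s < degree pi /\ t < degree pi /\
    forall w, overloaded w pi a (hash G pi a s b t) = false /\
      reveals w pi c b (hash G pi a s b t) = false.
Proof using Us_mono.
  intros Hcr Hrev Hunl Ha Hb [w0 HK].
  destruct (stable_stage (fun w f => overloaded w pi a f) (range pi)) as [W1 HW1].
  { intros w w' f; apply overloaded_mono. }
  destruct (stable_stage (fun w f => reveals w pi c b f) (range pi)) as [W2 HW2].
  { intros w w' f; apply reveals_mono. }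
  (* Past [w0] the short program for [b] has halted, so [some_unlucky] at [W] takes this [b] into
     account. *)
  set (W := w0 + W1 + W2).
  destruct (common_good_pair (half pi)
    (fun s t => overloaded W pi a (hash G pi a s b t))
    (fun s t => reveals W pi c b (hash G pi a s b t))) as (s & t & Hs & Ht & H1 & H2).
  - unfold half; lia.
  - intros s Hs; apply Nat.leb_gt, not_true_is_false; intros H.
    specialize (Hcr W); apply not_true_iff_false in Hcr; apply Hcr, andb_true_iff; split.
    + apply Nat.ltb_lt; auto.
    + apply bex_spec; exists s; auto.
  - intros t Ht; apply Nat.leb_gt, not_true_is_false; intros H.
    specialize (Hunl W); apply not_true_iff_false in Hunl; apply Hunl, andb_true_iff; split.
    + apply Nat.ltb_lt; auto.
    + apply bex_spec; exists b; split; auto.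
      specialize (Hrev W); apply Nat.ltb_ge in Hrev.
      rewrite !andb_true_iff; split; [|split].
      * eapply KS_lt_mono; [|exact HK]; unfold W; lia.
      * apply Nat.leb_le; auto.
      * apply bex_spec; exists t; auto.
  - exists s, t; split; [auto|split; [auto|]]; intros w; split.
    + apply (HW1 _ (hash_lt _ _ _ _ _ _) W); auto; unfold W; lia.
    + apply (HW2 _ (hash_lt _ _ _ _ _ _) W); auto; unfold W; lia.
Qed.

End Enumerations.

(** * The theorem *)

(** Additive constants are absorbed because [lg N >= 1]. The 4 and the 6 are there for [degree],
    which is [2 * (N + j + 6)] with [j <= N + c]. *)
Lemma le_pow_lg N c n : 2 <= N -> n <= N + c + 6 -> 4 * n < 2 ^ ((c + 12) * lg N).
Proof.
  intros HN Hn; unfold lg.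
  pose proof (Nat.log2_spec N ltac:(lia)) as [_ H].
  assert (1 <= Nat.log2 N) as H1 by (change 1 with (Nat.log2 2); apply Nat.log2_le_mono; auto).
  set (L := Nat.log2 N) in *.
  pose proof (Nat.pow_gt_lin_r 2 (c + 6) ltac:(lia)) as H2.
  assert (2 ^ (c + L + 10) <= 2 ^ ((c + 12) * L)) as H3 by (apply Nat.pow_le_mono_r; nia).
  eapply Nat.lt_le_trans; [|exact H3].
  assert (2 ^ S L <= 2 ^ (c + L + 7)) by (apply Nat.pow_le_mono_r; lia).
  assert (2 ^ (c + 6) <= 2 ^ (c + L + 7)) by (apply Nat.pow_le_mono_r; lia).
  replace (c + L + 10) with (3 + (c + L + 7)) by lia.
  rewrite (Nat.pow_add_r 2 3); change (2 ^ 3) with 8; lia.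
Qed.

(** Four nested pairs double four components and copy the fifth, giving 9; their separators give
    8. *)
Lemma length_params N c k j r m : 2 <= N ->
  k <= N + c -> j <= N + c -> r <= N + c -> m <= N + c ->
  length (dec (params N k j r m)) <= (9 * (c + 12) + 8) * lg N.
Proof.
  intros HN Hk Hj Hr Hm.
  assert (H : forall n, n <= N + c -> length (dec n) <= (c + 12) * lg N).
  { intros n Hn; apply length_dec_le; pose proof (le_pow_lg N c n HN ltac:(lia)); lia. }
  unfold params, npair; repeat rewrite ?dec_enc, length_pair_str.
  pose proof (H N ltac:(lia)); pose proof (H k Hk); pose proof (H j Hj);
    pose proof (H r Hr); pose proof (H m Hm).
  assert (1 <= lg N) by (unfold lg; change 1 with (Nat.log2 2); apply Nat.log2_le_mono; auto).
  nia.
Qed.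

Lemma enc_lt_words N a : length a <= N -> enc a < 2 ^ S N.
Proof.
  intros H; pose proof (enc_bounds a).
  assert (2 ^ S (length a) <= 2 ^ S N) by (apply Nat.pow_le_mono_r; lia); lia.
Qed.

Theorem theorem4 (U : decompressor) (HU : optimal U) :
  exists d : nat, forall (N : nat) (a b c : bstring),
    2 <= N ->
    length a <= N -> length b <= N -> length c <= N ->
    KS U a c >= KS U b c + KS U b a + d * lg N ->
    exists f : bstring,
      length f <= KS U b a + d * lg N /\
      KS U b (pair_str a f) <= d * lg N /\
      KS U b (pair_str c f) + d * lg N >= KS U b c.
Proof.
  destruct (computable_dec_stages U (proj1 HU)) as (Us & HUs & Hmono & HUUs & Hfun).
  destruct (computable_choice is_disperser is_disperser_computable is_disperser_exists)
    as (G & HG & Hdisp).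
  destruct (enumerations_computable Us G HUs HG) as (Hc1 & Hc2 & Hc3 & Hc4).
  destruct (KS_le_length U HU) as [c0 Hc0].
  destruct (KS_le_of_enumeration U _ HU Hc1) as [C1 HC1].
  destruct (KS_le_of_enumeration U _ HU Hc2) as [C2 HC2].
  destruct (KS_le_of_enumeration U _ HU Hc3) as [C3 HC3].
  destruct (KS_le_of_enumeration U _ HU Hc4) as [C4 HC4].
  clear Hc1 Hc2 Hc3 Hc4.
  (* [A] pays for one factor [degree], [K] for the parameters and the constants of the four
     descriptions. [e1] and [e2] are just large enough to push the descriptions of crowded and
     revealed strings below k and m. *)
  set (A := c0 + 12).
  set (K := 2 * (9 * A + 8) + C1 + C2 + C3 + C4).
  set (e1 := A + K + 1); set (e2 := K + 4).
  exists (e1 + e2 + 2 * A + K + 4); set (d := e1 + e2 + 2 * A + K + 4).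
  intros N a b c HN Ha Hb Hc Hac.
  set (L := lg N) in *.
  assert (HL : 1 <= L) by (unfold L, lg; change 1 with (Nat.log2 2); apply Nat.log2_le_mono; auto).
  assert (Hk : KS U b a <= N + c0) by (specialize (Hc0 b a); lia).
  assert (Hm : KS U b c <= N + c0) by (specialize (Hc0 b c); lia).
  set (k := KS U b a) in *; set (m := KS U b c) in *.
  set (j := k - e1 * L); set (r := m - e2 * L).
  set (pi := params N k j r m).
  destruct (params_spec N k j r m) as (EN & Ek & Ej & Er & Em); fold pi in EN, Ek, Ej, Er, Em.
  assert (Hpi : length (dec pi) <= (9 * A + 8) * L) by (apply length_params; lia).
  assert (HK : 2 * length (dec pi) + (C1 + C2 + C3 + C4) <= K * L).
  { replace (K * L) with (2 * ((9 * A + 8) * L) + (C1 + C2 + C3 + C4) * L) by (unfold K; ring).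
    apply Nat.add_le_mono; [lia|]; rewrite <- (Nat.mul_1_r (_ + C4)) at 1.
    apply Nat.mul_le_mono_l; auto. }
  assert (He1 : e1 * L = A * L + K * L + L) by (unfold e1; ring).
  assert (He2 : e2 * L = K * L + 4 * L) by (unfold e2; ring).
  assert (Hd : d * L = e1 * L + e2 * L + 2 * (A * L) + K * L + 4 * L) by (unfold d; ring).
  assert (HD : degree pi <= 2 ^ (A * L)).
  { unfold degree, half; rewrite EN, Ej.
    pose proof (le_pow_lg N c0 (N + c0 + 6) HN ltac:(lia)) as H; fold A L in H; lia. }
  assert (Hsmall : small pi = 2 ^ j) by (unfold small; rewrite Ej; auto).
  assert (Hwords : n_words pi = 2 ^ S N) by (unfold n_words; rewrite EN; auto).
  assert (HKS_lt : forall x y s, KS U x y < s -> exists w, KS_lt Us w s (enc y) (enc x) = true).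
  { intros x y s Hs; destruct (KS_program U y x HU) as (p & Hp & HUp).
    apply HUUs in HUp; destruct HUp as [w Hw]; exists w.
    apply bex_spec; exists (enc p); split; auto; apply length_lt_enc; lia. }
  assert (Hcrowded : forall w, crowded Us G w pi (enc a) (enc b) = false).
  { intros w; apply not_true_is_false; intros H.
    (* Truncated subtraction: for [j = 0] the margin [e1 * L] may not fit into k. *)
    destruct (Nat.eq_dec j 0) as [Hj|Hj].
    - apply andb_true_iff in H; destruct H as [_ H]; apply bex_spec in H.
      destruct H as (s & _ & H); apply Nat.leb_le in H.
      erewrite cnt_ext with (Q := fun _ => false) in H.
      + unfold cnt in H; rewrite sum_const in H; simpl in H; unfold half in H; lia.
      + intros t _; apply (not_overloaded Us G Hfun); lia.
    - assert (Hcard : card_le (fun x => exists w, crowded Us G w pi (enc a) x = true) (2 ^ (A * L + j))).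
      { eapply card_le_impl; [apply (card_crowded Us G Hmono Hfun Hdisp pi (enc a)); lia|auto|].
        rewrite Hsmall, Nat.pow_add_r; apply Nat.mul_le_mono_r; auto. }
      pose proof (HC2 pi _ a b w Hcard H) as HKS; fold k in HKS.
      unfold j in *; lia. }
  assert (Hrevealed : forall w, revealed Us w pi (enc c) (enc b) = false).
  { intros w; apply not_true_is_false; intros H.
    (* For [r = 0] the search in [KS_lt] ranges over [2 ^ 0 - 1 = 0] programs, so nothing is
       revealed. *)
    destruct (Nat.eq_dec r 0) as [Hr|Hr].
    - apply Nat.ltb_lt in H; rewrite cnt_ext with (Q := fun _ => false) in H.
      + unfold cnt in H; rewrite sum_const in H; simpl in H; lia.
      + intros f _; unfold reveals; rewrite Er, Hr; reflexivity.
    - pose proof (card_revealed Us Hmono Hfun pi (enc c)) as Hcard; rewrite Er in Hcard.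
      pose proof (HC3 pi _ c b w Hcard H) as HKS; fold m in HKS.
      unfold r in *; lia. }
  assert (Hunlucky : forall w, some_unlucky Us G w pi (enc c) (enc a) = false).
  { intros w; apply not_true_is_false; intros H.
    assert (Hcard : card_le (fun x => exists w, some_unlucky Us G w pi (enc c) x = true)
      (2 ^ (S m + (A * L + j)))).
    { eapply card_le_impl; [apply (card_some_unlucky Us G Hmono Hfun Hdisp pi (enc c))|auto|].
      rewrite Em, Hsmall, (Nat.pow_add_r 2 (S m)), (Nat.pow_add_r 2 (A * L)).
      apply Nat.mul_le_mono_l, Nat.mul_le_mono_r; auto. }
    (* Here the lower bound on [KS U a c] enters: this description of [a] has about m + j bits, and
       [j <= k]. *)
    pose proof (HC4 pi _ c a w Hcard H) as HKS.
    unfold j in *; lia. }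
  destruct (good_hash_value Us G Hmono pi (enc a) (enc b) (enc c)) as (s & t & Hs & Ht & Hgood); auto.
  - rewrite Hwords; apply enc_lt_words; auto.
  - rewrite Hwords; apply enc_lt_words; auto.
  - rewrite Em; apply HKS_lt; fold m; lia.
  - set (f := hash G pi (enc a) s (enc b) t) in *.
    exists (dec f); split; [|split].
    + assert (length (dec f) <= j + 3).
      { apply length_dec_le; pose proof (hash_lt G pi (enc a) s (enc b) t) as H.
        unfold range in H; rewrite Ej in H; exact H. }
      unfold j in *; lia.
    + destruct (HKS_lt b a (S k)) as [w Hw]; [fold k; lia|].
      assert (Hload : loaded Us G w pi (npair (enc a) f) (enc b) = true).
      { unfold loaded, load; rewrite nfst_npair, nsnd_npair, Ek, Hw, !andb_true_iff.
        split; [apply Nat.ltb_lt; rewrite Hwords; apply enc_lt_words; auto|split; auto].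
        apply bex_spec; exists s; split; auto; apply bex_spec; exists t; split; auto.
        apply Nat.eqb_refl. }
      (* [max_load] in powers of 2: [S k - j] is at most [S (e1 * L)], also when [j] is truncated,
         and each factor [degree] adds [A * L]. *)
      assert (Hcard : card_le (fun x => exists w, loaded Us G w pi (npair (enc a) f) x = true)
        (2 ^ (S (e1 * L) + (A * L + A * L)))).
      { eapply card_le_impl; [apply (card_loaded Us G Hmono pi (enc a) f); intros; apply Hgood|auto|].
        unfold max_load; rewrite Ek, Ej, !(Nat.pow_add_r 2).
        apply Nat.mul_le_mono; [apply Nat.pow_le_mono_r; unfold j; lia|].
        apply Nat.mul_le_mono; auto. }
      rewrite <- (enc_dec f), npair_enc in Hload, Hcard.
      pose proof (HC1 pi _ (pair_str a (dec f)) b w Hcard Hload) as HKS.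
      lia.
    + assert (r <= KS U b (pair_str c (dec f))).
      { apply Nat.le_ngt; intros H; apply HKS_lt in H; destruct H as [w Hw].
        destruct (Hgood w) as [_ Hrev]; unfold reveals in Hrev.
        rewrite Er, <- (enc_dec f), npair_enc, Hw in Hrev; discriminate. }
      unfold r in *; lia.
Qed.
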